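(* Suppose $\bar\Lambda/\operatorname{Jac}(\bar\Lambda)$ to be split semisimple over $\bar S$, i.e. suppose all simple $\bar\Lambda$-modules to be absolutely simple. Then the number of isomorphism classes of simple $\bar\Lambda$-modules is given by $$\mathrm z(\Lambda)=\sum_{\sigma\in\operatorname{Cl}_{p'}(G)}\dim_{\bar S}(\bar T_0/V_\sigma).$$
   Context: A finite group $G$ acts (from the right, $y\mapsto y^\sigma$, by field automorphisms, not necessarily faithfully) on a field $L$ with fixed field $K$. (No condition on the characteristic of $L$ is imposed.) Let $S\subset K$ be a discrete valuation ring with field of fractions $K$, maximal ideal generated by $\pi$, and residue field $\bar S=S/\pi S$, which is assumed to be finite, of characteristic $p$. Let $T$ be the integral closure of $S$ in $L$; it is $G$-stable. Let $\bar T=T/\pi T$ and $\bar T_0=\bar T/\operatorname{Jac}(\bar T)=T/\operatorname{Jac}(T)$, both with the induced $G$-operation. For a commutative ring $C$ with (right) $G$-operation, the twisted group ring $C\wr G$ is the free right $C$-module on $G$ with multiplication determined by $(\sigma y)(\tau z)=(\sigma\tau)(y^\tau z)$ for $\sigma,\tau\in G$, $y,z\in C$. Put $\Lambda=T\wr G$ and $\bar\Lambda=\bar T\wr G$, an $\bar S$-algebra. $\operatorname{Jac}$ denotes the Jacobson radical. For $\sigma\in G$ let $V_\sigma\subset\bar T_0$ be the $\bar S$-linear span of all elements $(y^\sigma-y)z$ and $y^\rho-y$, with $y,z\in\bar T_0$ and $\rho\in C_G(\sigma)$, the centralizer of $\sigma$. Let $\operatorname{Cl}_{p'}(G)$ be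 a set of representatives of the conjugacy classes of elements of $G$ of order not divisible by $p$. *)

(* Defs.v *)
From HB Require Import structures.
From mathcomp Require Import all_boot all_order all_fingroup all_algebra.
From mathcomp Require Import mathcomp_extra boolp classical_sets cardinality.

Set Implicit Arguments.
Unset Strict Implicit.
Unset Printing Implicit Defensive.

Import GRing.Theory.

Local Open Scope classical_set_scope.
Local Open Scope quotient_scope.
Local Open Scope ring_scope.

(* MathComp's predicates on a ring do not come with a ring structure on the
   type of their elements; the next two records provide it for subrings and
   subfields. *)
Record subring_type (R : comNzRingType) (P : subringClosed R) :=
  SubringElt { subring_val : R; _ : subring_val \in P }.

Section SubringType.
Variables (R : comNzRingType) (P : subringClosed R).
HB.instance Definition _ := [isSub for @subring_val R P].
HB.instance Definition _ := [Choice of subring_type P by <:].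
HB.instance Definition _ :=
  [SubChoice_isSubComNzRing of subring_type P by <:].
End SubringType.

Record subfield_type (F : fieldType) (P : divringClosed F) :=
  SubfieldElt { subfield_val : F; _ : subfield_val \in P }.

Section SubfieldType.
Variables (F : fieldType) (P : divringClosed F).
HB.instance Definition _ := [isSub for @subfield_val F P].
HB.instance Definition _ := [Choice of subfield_type P by <:].
HB.instance Definition _ :=
  [SubChoice_isSubComUnitRing of subfield_type P by <:].
HB.instance Definition _ :=
  [SubComUnitRing_isSubIntegralDomain of subfield_type P by <:].
HB.instance Definition _ :=
  [SubIntegralDomain_isSubField of subfield_type P by <:].
End SubfieldType.

Record ideal (R : comPzRingType) := Ideal {
  ideal_set :> R -> Prop;
  ideal0 : ideal_set 0;
  idealD : forall x y, ideal_set x -> ideal_set y -> ideal_set (x + y);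
  idealM : forall a x, ideal_set x -> ideal_set (a * x) }.

Section Ideals.
Variable R : comPzRingType.
Implicit Types I J : ideal R.

Definition maximal_ideal I : Prop :=
  ~ I 1 /\
  forall J, (forall x, I x -> J x) -> ~ J 1 -> forall x, J x -> I x.

Definition principal_set (a x : R) : Prop := exists b, x = b * a.

Lemma principal0 a : principal_set a 0.
Proof. by exists 0; rewrite mul0r. Qed.

Lemma principalD a x y :
  principal_set a x -> principal_set a y -> principal_set a (x + y).
Proof. by move=> [b ->] [c ->]; exists (b + c); rewrite mulrDl. Qed.

Lemma principalM a b x : principal_set a x -> principal_set a (b * x).
Proof. by move=> [c ->]; exists (b * c); rewrite mulrA. Qed.

Definition principal (a : R) : ideal R :=
  Ideal (principal0 a) (@principalD a) (@principalM a).

Definition Jac_set (x : R) : Prop := forall M, maximal_ideal M -> M x.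

Lemma Jac0 : Jac_set 0.
Proof. by move=> M _; exact: ideal0. Qed.

Lemma JacD x y : Jac_set x -> Jac_set y -> Jac_set (x + y).
Proof. by move=> hx hy M hM; apply: idealD; [exact: hx | exact: hy]. Qed.

Lemma JacM a x : Jac_set x -> Jac_set (a * x).
Proof. by move=> hx M hM; apply: idealM; exact: hx. Qed.

Definition Jac : ideal R := Ideal Jac0 JacD JacM.

End Ideals.

(* A discrete valuation ring with uniformizer pi: a principal ideal domain
   which is not a field and whose only maximal ideal is the one generated by
   pi. *)
Definition is_dvr (R : comNzRingType) (pi : R) : Prop :=
  [/\ GRing.integral_domain_axiom R,
      forall I : ideal R, exists a, forall x, I x <-> principal a x,
      pi != 0,
      maximal_ideal (principal pi) &
      forall M : ideal R, maximal_ideal M -> forall x, M x <-> principal pi x].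

(* The library's {ideal_quot I} requires I to be proper; the quotients below
   are taken in possibly zero rings, so no properness has to be established
   beforehand. *)
Section RingQuotient.
Variables (R : comPzRingType) (I : ideal R).

Definition ideal_pred : {pred R} := [pred x : R | `[< I x >]].

Lemma ideal_pred_zmod_closed : zmod_closed ideal_pred.
Proof.
split=> [|x y /asboolP hx /asboolP hy]; apply/asboolP; first exact: ideal0.
by apply: idealD => //; rewrite -mulN1r; apply: idealM.
Qed.

HB.instance Definition _ :=
  GRing.isZmodClosed.Build R ideal_pred ideal_pred_zmod_closed.

Definition rquot : Type := Quotient.quot ideal_pred.
HB.instance Definition _ := GRing.Zmodule.on rquot.

Definition rpi (x : R) : rquot := \pi_(Quotient.quot ideal_pred) x.

Definition rrepr (x : rquot) : R := generic_quotient.repr (x : Quotient.quot ideal_pred).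

Lemma rreprK x : rpi (rrepr x) = x.
Proof. exact: reprK. Qed.

Lemma rpi_eq x y : rpi x = rpi y <-> I (x - y).
Proof.
split=> [/eqP|h].
  by rewrite -Quotient.idealrBE => /asboolP.
by apply/eqP; rewrite -Quotient.idealrBE; apply/asboolP.
Qed.

Lemma rreprP x : I (rrepr (rpi x) - x).
Proof. by apply/rpi_eq; rewrite rreprK. Qed.

Lemma rpiB : {morph rpi : x y / x - y}.
Proof. exact: raddfB. Qed.

Definition rquot_mul (x y : rquot) := rpi (rrepr x * rrepr y).

Lemma rpiM x y : rpi (x * y) = rquot_mul (rpi x) (rpi y).
Proof.
apply/esym/rpi_eq.
set x' := rrepr _; set y' := rrepr _.
have -> : x' * y' - x * y = y' * (x' - x) + x * (y' - y).
  by rewrite !mulrBr (mulrC y' x') (mulrC y' x) addrA subrK.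
by apply: idealD; apply: idealM; exact: rreprP.
Qed.

Lemma rquot_mulA : associative rquot_mul.
Proof.
by move=> x y z; rewrite -[x]rreprK -[y]rreprK -[z]rreprK -!rpiM mulrA.
Qed.

Lemma rquot_mulC : commutative rquot_mul.
Proof. by move=> x y; rewrite -[x]rreprK -[y]rreprK -!rpiM mulrC. Qed.

Lemma rquot_mul1 : left_id (rpi 1) rquot_mul.
Proof. by move=> x; rewrite -[x]rreprK -!rpiM mul1r. Qed.

Lemma rpiD : {morph rpi : x y / x + y}.
Proof. exact: raddfD. Qed.

Lemma rquot_mulDl : left_distributive rquot_mul +%R.
Proof.
move=> x y z; rewrite -[x]rreprK -[y]rreprK -[z]rreprK.
by rewrite -rpiD -!rpiM mulrDl rpiD.
Qed.

HB.instance Definition _ := GRing.Zmodule_isComPzRing.Build rquot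
  rquot_mulA rquot_mulC rquot_mul1 rquot_mulDl.

HB.instance Definition _ := GRing.isZmodMorphism.Build R rquot rpi rpiB.

Lemma rpi_monoid_morphism : monoid_morphism rpi.
Proof. by split=> // x y; rewrite rpiM. Qed.

HB.instance Definition _ :=
  GRing.isMonoidMorphism.Build R rquot rpi rpi_monoid_morphism.

End RingQuotient.

Section QuotientMap.
Variables (R R' : comPzRingType) (I : ideal R) (I' : ideal R').
Variables (f : {rmorphism R -> R'}) (hf : forall x, I x -> I' (f x)).

Definition qmap_fun (x : rquot I) : rquot I' := rpi I' (f (rrepr x)).

Lemma qmap_funE x : qmap_fun (rpi I x) = rpi I' (f x).
Proof. by apply/rpi_eq; rewrite -rmorphB; apply: hf; exact: rreprP. Qed.

Lemma qmap_zmod_morphism : zmod_morphism qmap_fun.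
Proof.
move=> x y; rewrite -[x]rreprK -[y]rreprK -rmorphB !qmap_funE.
by rewrite !rmorphB.
Qed.

Lemma qmap_monoid_morphism : monoid_morphism qmap_fun.
Proof.
split=> [|x y]; first by rewrite -(rmorph1 (rpi I)) qmap_funE !rmorph1.
by rewrite -[x]rreprK -[y]rreprK -rmorphM !qmap_funE !rmorphM.
Qed.

HB.instance Definition _ :=
  GRing.isZmodMorphism.Build _ _ qmap_fun qmap_zmod_morphism.
HB.instance Definition _ :=
  GRing.isMonoidMorphism.Build _ _ qmap_fun qmap_monoid_morphism.

Definition qmap : {rmorphism rquot I -> rquot I'} := qmap_fun.

Lemma qmapE x : qmap (rpi I x) = rpi I' (f x).
Proof. exact: qmap_funE. Qed.

End QuotientMap.

(* A right action by ring automorphisms, not necessarily faithful;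
   [a s y] stands for y ^ s. *)
Record ring_action (G : finGroupType) (C : pzRingType) := RingAction {
  ract :> G -> {rmorphism C -> C};
  ract1 : forall y, ract 1%g y = y;
  ractM : forall s t y, ract (s * t)%g y = ract t (ract s y) }.

Section QuotientAction.
Variables (G : finGroupType) (C : comPzRingType) (a : ring_action G C).
Variables (I : ideal C) (hI : forall s x, I x -> I (a s x)).

Let qa s := qmap (hI s).

Lemma qact1 y : qa 1%g y = y.
Proof. by rewrite -[y]rreprK qmapE ract1. Qed.

Lemma qactM s t y : qa (s * t)%g y = qa t (qa s y).
Proof. by rewrite -[y]rreprK /qa !qmapE ractM. Qed.

Definition quot_action : ring_action G (rquot I) := RingAction qact1 qactM.

End QuotientAction.

Section JacStable.
Variables (G : finGroupType) (C : comPzRingType) (a : ring_action G C).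

Section Preimage.
Variables (s : G) (M : ideal C).

Lemma preim0 : M (a s 0).
Proof. by rewrite rmorph0; exact: ideal0. Qed.

Lemma preimD x y : M (a s x) -> M (a s y) -> M (a s (x + y)).
Proof. by move=> hx hy; rewrite rmorphD; exact: idealD. Qed.

Lemma preimM b x : M (a s x) -> M (a s (b * x)).
Proof. by move=> hx; rewrite rmorphM; exact: idealM. Qed.

Definition preim_ideal : ideal C :=
  @Ideal C (fun x => M (a s x)) preim0 preimD preimM.

End Preimage.

Lemma ractK s : cancel (a s) (a s^-1%g).
Proof. by move=> x; rewrite -ractM mulgV ract1. Qed.

Lemma ractKV s : cancel (a s^-1%g) (a s).
Proof. by move=> x; rewrite -ractM mulVg ract1. Qed.

Lemma preim_maximal s M : maximal_ideal M -> maximal_ideal (preim_ideal s M).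
Proof.
move=> [M1 hM]; split=> [|J hJ J1 x Jx]; first by rewrite /= rmorph1.
apply: (hM (preim_ideal s^-1%g J)) => /=; last by rewrite ractK.
  by move=> y My; apply: hJ => /=; rewrite ractKV.
by rewrite rmorph1.
Qed.

Lemma Jac_stable s x : Jac C x -> Jac C (a s x).
Proof. by move=> hx M /(@preim_maximal s)/hx. Qed.

End JacStable.

(* The twisted group ring C wr G: the family x : {ffun G -> C} stands for
   \sum_s s (x s). *)
Definition twisted (G : finGroupType) (C : pzRingType) (a : ring_action G C) :
  Type := {ffun G -> C}.

Section Twisted.
Variables (G : finGroupType) (C : pzRingType) (a : ring_action G C).
Local Notation A := (twisted a).

HB.instance Definition _ := GRing.Zmodule.on A.

Definition tw_elt (s : G) (y : C) : A := [ffun t => if t == s then y else 0].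

Definition tw_one : A := tw_elt 1%g 1.

Definition tw_mul (x y : A) : A :=
  [ffun r => \sum_t a t (x (r * t^-1)%g) * y t].

(* (s y) (t z) = (s t) (y^t z) *)
Lemma tw_mul_elt s t y z :
  tw_mul (tw_elt s y) (tw_elt t z) = tw_elt (s * t)%g (a t y * z).
Proof.
apply/ffunP=> r; rewrite !ffunE (bigD1 t) //= big1 => [|u /negPf ut].
  rewrite addr0 !ffunE eqxx.
  have -> : (r * t^-1 == s)%g = (r == s * t)%g.
    by apply/eqP/eqP=> [<-|->]; rewrite ?mulgKV ?mulgK.
  by case: ifP => // _; rewrite rmorph0 mul0r.
by rewrite !ffunE ut mulr0.
Qed.

Lemma tw_mulA : associative tw_mul.
Proof.
move=> x y z; apply/ffunP=> r; rewrite !ffunE.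
under eq_bigr do rewrite !ffunE mulr_sumr.
under [RHS]eq_bigr do rewrite !ffunE rmorph_sum mulr_suml.
rewrite exchange_big; apply: eq_bigr => t _.
rewrite (reindex_inj (mulIg t)) /=; apply: eq_bigr => u _.
by rewrite rmorphM ractM invMg !mulgA mulgK mulrA.
Qed.

Lemma tw_mul1l : left_id tw_one tw_mul.
Proof.
move=> x; apply/ffunP=> r; rewrite !ffunE (bigD1 r) //= big1 => [|t tr].
  by rewrite addr0 ffunE mulgV eqxx rmorph1 mul1r.
by rewrite ffunE -eq_mulgV1 eq_sym (negPf tr) rmorph0 mul0r.
Qed.

Lemma tw_mul1r : right_id tw_one tw_mul.
Proof.
move=> x; apply/ffunP=> r; rewrite !ffunE (bigD1 1%g) //= big1 => [|t /negPf tr].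
  by rewrite addr0 ffunE eqxx mulr1 invg1 mulg1 ract1.
by rewrite ffunE tr mulr0.
Qed.

Lemma tw_mulDl : left_distributive tw_mul +%R.
Proof.
move=> x y z; apply/ffunP=> r; rewrite !ffunE -big_split /=.
by apply: eq_bigr => t _; rewrite ffunE rmorphD mulrDl.
Qed.

Lemma tw_mulDr : right_distributive tw_mul +%R.
Proof.
move=> x y z; apply/ffunP=> r; rewrite !ffunE -big_split /=.
by apply: eq_bigr => t _; rewrite ffunE mulrDr.
Qed.

HB.instance Definition _ := GRing.Zmodule_isPzRing.Build A
  tw_mulA tw_mul1l tw_mul1r tw_mulDl tw_mulDr.

(* The coefficient ring inside the twisted group ring, y |-> 1 y. *)
Definition tw_const : C -> A := tw_elt 1%g.

Lemma tw_const_zmod_morphism : zmod_morphism tw_const.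
Proof.
by move=> x y; apply/ffunP=> r; rewrite !ffunE; case: ifP; rewrite ?subr0.
Qed.

Lemma tw_const_monoid_morphism : monoid_morphism tw_const.
Proof.
split=> // x y; rewrite /tw_const.
have -> : (tw_elt 1%g x : A) * tw_elt 1%g y = tw_mul (tw_elt 1%g x) (tw_elt 1%g y).
  by [].
by rewrite tw_mul_elt mulg1 ract1.
Qed.

HB.instance Definition _ :=
  GRing.isZmodMorphism.Build C A tw_const tw_const_zmod_morphism.
HB.instance Definition _ :=
  GRing.isMonoidMorphism.Build C A tw_const tw_const_monoid_morphism.

End Twisted.

Definition simple_module (A : pzRingType) (V : lmodType A) : Prop :=
  (exists v : V, v != 0) /\
  forall U : {pred V}, submod_closed U -> U =i pred1 0 \/ U =i predT.

Definition isomorphic (A : pzRingType) (V W : lmodType A) : Prop :=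
  exists f : {linear V -> W}, bijective f.

(* There are exactly n isomorphism classes of simple A-modules. *)
Definition num_simple_modules (A : pzRingType) (n : nat) : Prop :=
  exists M : 'I_n -> lmodType A,
    [/\ forall i, simple_module (M i),
        forall i j, isomorphic (M i) (M j) -> i = j &
        forall V : lmodType A, simple_module V ->
          exists i, isomorphic V (M i)].

(* Let j : k -> A make A a k-algebra, f : k -> E be a field extension, and V
   an A-module.  The E-vector space W, with the E-linear maps rho x for x in
   A and the map iota : V -> W, is the tensor product of E and V over k: iota
   is the universal k-linear map from V to E-vector spaces, and x in A acts
   on e \otimes v = e *: iota v as e \otimes (x *: v). *)
Definition is_scalar_extension (k A : pzRingType) (j : {rmorphism k -> A})
    (V : lmodType A) (E : fieldType) (f : {rmorphism k -> E})
    (W : lmodType E) (rho : A -> {linear W -> W}) (iota : {additive V -> W}) :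
    Prop :=
  [/\ forall c v, iota (j c *: v) = f c *: iota v,
      forall x v, rho x (iota v) = iota (x *: v) &
      forall (X : lmodType E) (g : {additive V -> X}),
        (forall c v, g (j c *: v) = f c *: g v) ->
        (exists h : {linear W -> X}, forall v, h (iota v) = g v) /\
        (forall h h' : {linear W -> X},
           (forall v, h (iota v) = h' (iota v)) -> h =1 h')].

(* V is simple and remains so, over E \otimes_k A, after every extension E
   of the field k; an (E \otimes_k A)-submodule of E \otimes_k V is an
   E-subspace that is stable under A. *)
Definition absolutely_simple (k A : pzRingType) (j : {rmorphism k -> A})
    (V : lmodType A) : Prop :=
  simple_module V /\
  forall (E : fieldType) (f : {rmorphism k -> E}) (W : lmodType E)
      (rho : A -> {linear W -> W}) (iota : {additive V -> W}),
    is_scalar_extension j f rho iota ->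
    (exists w : W, w != 0) /\
    forall U : {pred W}, submod_closed U ->
      (forall x w, w \in U -> rho x w \in U) ->
      U =i pred1 0 \/ U =i predT.

Definition is_basis (k : pzRingType) (M : lmodType k) (n : nat)
    (e : 'I_n -> M) : Prop :=
  forall m : M, exists! c : {ffun 'I_n -> k}, m = \sum_i c i *: e i.

(* The dimension over k (0 if there is no finite basis); it is only used when
   k is a field. *)
Definition mdim (k : pzRingType) (M : lmodType k) : nat :=
  xget 0%N [set n | exists e : 'I_n -> M, is_basis e].

Section Span.
Variables (k : pzRingType) (M : lmodType k) (X : set M).

Definition mspan : {pred M} :=
  [pred m | `[< forall U : {pred M}, submod_closed U ->
                  (forall x, X x -> x \in U) -> m \in U >]].

Lemma mspan_submod_closed : submod_closed mspan.
Proof.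
split=> [|c x y /asboolP hx /asboolP hy]; apply/asboolP=> U hU XU.
  by case: hU.
by case: (hU) => _; apply; [exact: hx | exact: hy].
Qed.

End Span.

Section ModuleQuotient.
Variables (k : pzRingType) (M : lmodType k).
Variables (U : {pred M}) (hU : submod_closed U).

Definition submod_pred of submod_closed U : {pred M} := U.
Local Notation V := (submod_pred hU).

HB.instance Definition _ :=
  GRing.isZmodClosed.Build M V (GRing.submod_closedB hU).

Definition mquot : Type := Quotient.quot V.
HB.instance Definition _ := GRing.Zmodule.on mquot.

Definition mpi (x : M) : mquot := \pi_(Quotient.quot V) x.

Definition mrepr (x : mquot) : M :=
  generic_quotient.repr (x : Quotient.quot V).

Lemma mreprK x : mpi (mrepr x) = x.
Proof. exact: reprK. Qed.

Lemma mpi_eq x y : mpi x = mpi y <-> x - y \in U.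
Proof.
split=> [/eqP|h]; first by rewrite -Quotient.idealrBE.
by apply/eqP; rewrite -Quotient.idealrBE.
Qed.

Lemma mpiD : {morph mpi : x y / x + y}.
Proof. exact: raddfD. Qed.

Definition mquot_scale (c : k) (x : mquot) : mquot := mpi (c *: mrepr x).

Lemma mpiZ c x : mpi (c *: x) = mquot_scale c (mpi x).
Proof.
apply/esym/mpi_eq; rewrite -scalerBr -[c *: _]addr0.
by case: (hU) => U0; apply=> //; apply/mpi_eq/mreprK.
Qed.

Lemma mquot_scaleA a b x :
  mquot_scale a (mquot_scale b x) = mquot_scale (a * b) x.
Proof. by rewrite -[x]mreprK -!mpiZ scalerA. Qed.

Lemma mquot_scale1 : left_id 1 mquot_scale.
Proof. by move=> x; rewrite -[x]mreprK -mpiZ scale1r. Qed.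

Lemma mquot_scaleDr : right_distributive mquot_scale +%R.
Proof.
by move=> a x y; rewrite -[x]mreprK -[y]mreprK -mpiD -!mpiZ -mpiD scalerDr.
Qed.

Lemma mquot_scaleDl x : {morph mquot_scale^~ x : a b / a + b}.
Proof. by move=> a b; rewrite -[x]mreprK -!mpiZ -mpiD scalerDl. Qed.

HB.instance Definition _ := GRing.Zmodule_isLmodule.Build k mquot
  mquot_scaleA mquot_scale1 mquot_scaleDr mquot_scaleDl.

End ModuleQuotient.

Section Setting.
Variables (G : finGroupType) (L : fieldType) (a : ring_action G L).

Definition fixed_pred : {pred L} := [pred y | [forall s, a s y == y]].

Lemma fixed_predP y : reflect (forall s, a s y = y) (y \in fixed_pred).
Proof. exact: 'forall_eqP. Qed.

Lemma fixed_divring_closed : divring_closed fixed_pred.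
Proof.
split=> [|x y /fixed_predP hx /fixed_predP hy|x y /fixed_predP hx /fixed_predP hy].
- by apply/fixed_predP=> s; rewrite rmorph1.
- by apply/fixed_predP=> s; rewrite rmorphB hx hy.
- by apply/fixed_predP=> s; rewrite fmorph_div hx hy.
Qed.

HB.instance Definition _ :=
  GRing.isDivringClosed.Build L fixed_pred fixed_divring_closed.

(* K, the subfield of L fixed by G *)
Definition fixed_field : fieldType := subfield_type fixed_pred.

Variable S : subringClosed fixed_field.

Definition fraction_field_cond : Prop :=
  forall x : fixed_field, exists b c : subring_type S,
    val c != 0 /\ x = val b / val c.

Definition S_to_L : {rmorphism subring_type S -> L} :=
  (val : fixed_field -> L) \o (val : subring_type S -> fixed_field).

Definition T_pred : {pred L} := [pred y | `[< integralOver S_to_L y >]].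

Lemma T_subring_closed : subring_closed T_pred.
Proof.
split=> [|x y /asboolP hx /asboolP hy|x y /asboolP hx /asboolP hy].
- by apply/asboolP; exact: integral1.
- by apply/asboolP; exact: integral_sub.
- by apply/asboolP; exact: integral_mul.
Qed.

HB.instance Definition _ :=
  GRing.isSubringClosed.Build L T_pred T_subring_closed.

(* T, the integral closure of S in L *)
Definition T_ring : comNzRingType := subring_type T_pred.

Lemma S_to_L_in_T x : S_to_L x \in T_pred.
Proof. by apply/asboolP; exact: integral_id. Qed.

Definition S_to_T_fun (x : subring_type S) : T_ring :=
  SubringElt (S_to_L_in_T x).

Lemma S_to_T_zmod_morphism : zmod_morphism S_to_T_fun.
Proof. by move=> x y; apply: val_inj; exact: (rmorphB S_to_L). Qed.

Lemma S_to_T_monoid_morphism : monoid_morphism S_to_T_fun.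
Proof.
split=> [|x y]; apply: val_inj; first exact: (rmorph1 S_to_L).
exact: (rmorphM S_to_L).
Qed.

HB.instance Definition _ := GRing.isZmodMorphism.Build (subring_type S) T_ring
  S_to_T_fun S_to_T_zmod_morphism.
HB.instance Definition _ := GRing.isMonoidMorphism.Build (subring_type S) T_ring
  S_to_T_fun S_to_T_monoid_morphism.

Definition S_to_T : {rmorphism subring_type S -> T_ring} := S_to_T_fun.

Lemma act_S_to_L s x : a s (S_to_L x) = S_to_L x.
Proof. by case: x => [[x hx] Sx] /=; apply: (fixed_predP _ hx). Qed.

Lemma T_stable s y : y \in T_pred -> a s y \in T_pred.
Proof.
move=> /asboolP hy; apply/asboolP.
have [p pm py] := integral_rmorph (a s) hy.
exists p => //; rewrite -(eq_map_poly (f := a s \o S_to_L)) //.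
exact: act_S_to_L.
Qed.

Definition T_act_fun (s : G) (y : T_ring) : T_ring :=
  SubringElt (T_stable s (valP y)).

Lemma T_act_zmod_morphism s : zmod_morphism (T_act_fun s).
Proof. by move=> x y; apply: val_inj; exact: (rmorphB (a s)). Qed.

Lemma T_act_monoid_morphism s : monoid_morphism (T_act_fun s).
Proof.
split=> [|x y]; apply: val_inj; first exact: (rmorph1 (a s)).
exact: (rmorphM (a s)).
Qed.

HB.instance Definition _ s := GRing.isZmodMorphism.Build T_ring T_ring
  (T_act_fun s) (T_act_zmod_morphism s).
HB.instance Definition _ s := GRing.isMonoidMorphism.Build T_ring T_ring
  (T_act_fun s) (T_act_monoid_morphism s).

Lemma T_act1 y : T_act_fun 1%g y = y.
Proof. by apply: val_inj; rewrite /= ract1. Qed.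

Lemma T_actM s t y : T_act_fun (s * t)%g y = T_act_fun t (T_act_fun s y).
Proof. by apply: val_inj; rewrite /= ractM. Qed.

Definition T_action : ring_action G T_ring :=
  @RingAction G T_ring (fun s => T_act_fun s) T_act1 T_actM.

Variable pi : subring_type S.

Definition Sbar : comPzRingType := rquot (principal pi).

Definition piT : ideal T_ring := principal (S_to_T pi).

Definition Tbar : comPzRingType := rquot piT.

Lemma piT_stable s y : piT y -> piT (T_action s y).
Proof.
move=> [b ->]; exists (T_action s b); rewrite rmorphM; congr (_ * _).
by apply: val_inj; exact: act_S_to_L.
Qed.

Definition Tbar_action : ring_action G Tbar := quot_action piT_stable.

Definition Tbar0 : Type := rquot (Jac Tbar).
HB.instance Definition _ := GRing.ComPzRing.on Tbar0.

Definition Tbar0_action : ring_action G Tbar0 :=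
  quot_action (@Jac_stable G Tbar Tbar_action).

Lemma S_to_T_principal x : principal pi x -> piT (S_to_T x).
Proof. by move=> [b ->]; exists (S_to_T b); rewrite rmorphM. Qed.

Definition Sbar_to_Tbar : {rmorphism Sbar -> Tbar} := qmap S_to_T_principal.

Definition Sbar_to_Tbar0 : {rmorphism Sbar -> Tbar0} :=
  rpi (Jac Tbar) \o Sbar_to_Tbar.

Definition Tbar0_scale (c : Sbar) (y : Tbar0) : Tbar0 := Sbar_to_Tbar0 c * y.

Lemma Tbar0_scaleA c d y :
  Tbar0_scale c (Tbar0_scale d y) = Tbar0_scale (c * d) y.
Proof. by rewrite /Tbar0_scale rmorphM mulrA. Qed.

Lemma Tbar0_scale1 : left_id 1 Tbar0_scale.
Proof. by move=> y; rewrite /Tbar0_scale rmorph1 mul1r. Qed.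

Lemma Tbar0_scaleDr : right_distributive Tbar0_scale +%R.
Proof. by move=> c x y; rewrite /Tbar0_scale mulrDr. Qed.

Lemma Tbar0_scaleDl y : {morph Tbar0_scale^~ y : c d / c + d}.
Proof. by move=> c d; rewrite /Tbar0_scale rmorphD mulrDl. Qed.

HB.instance Definition _ := GRing.Zmodule_isLmodule.Build Sbar Tbar0
  Tbar0_scaleA Tbar0_scale1 Tbar0_scaleDr Tbar0_scaleDl.

Definition V_gen (sigma : G) : set Tbar0 :=
  [set x | (exists y z : Tbar0, x = (Tbar0_action sigma y - y) * z) \/
           (exists2 rho, rho \in 'C[sigma]%g &
              exists y : Tbar0, x = Tbar0_action rho y - y)].

Definition V_space (sigma : G) : {pred Tbar0} := mspan (V_gen sigma).

Definition Tbar0_mod_V (sigma : G) : lmodType Sbar :=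
  mquot (mspan_submod_closed (V_gen sigma)).

Definition Lambda_bar : pzRingType := twisted Tbar_action.

Definition Sbar_to_Lambda_bar : {rmorphism Sbar -> Lambda_bar} :=
  tw_const Tbar_action \o Sbar_to_Tbar.

End Setting.

(* X is a set of representatives of the conjugacy classes of the elements of
   G of order not divisible by p. *)
Definition p'class_reps (G : finGroupType) (p : nat) (X : {set G}) : Prop :=
  (forall s, s \in X -> ~~ (p %| #[s]%g)%N) /\
  (forall t : G, ~~ (p %| #[t]%g)%N ->
     exists! s, s \in X /\ s \in (t ^: [set: G]%SET)%g).

(* Main.v *)
Require Import Defs.
From HB Require Import structures.
From mathcomp Require Import all_boot all_order all_fingroup all_algebra.
From mathcomp Require Import closed_field cyclic.
From mathcomp Require Import mathcomp_extra boolp classical_sets cardinality.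
From mathcomp Require Import zify.

(* Call f : A -> U a trace function if it is additive and f (x y) = f (y x).
   When p U = 0, x |-> f (x ^ p) is again a trace function.

   For a split finite algebra A over a finite field k of characteristic p, with
   simple modules V_1, ..., V_r, the density theorem makes the map
   chi = (tr_V_i)_i : A -> k^r onto, and, since trace zero matrices are sums of
   commutators and the radical is nil, any trace function which vanishes on
   nilpotent elements vanishes on ker chi.

   For A = Tbar wr G, summing the coefficients over a conjugacy class of
   p'-elements t, after transport to t, gives a trace function onto
   Tbar_0 / V_t.  Compose these functions with x |-> x ^ Q, where Q is a power
   of p so large that it kills nilpotent elements and that s ^ Q is a p'-element
   for all s in G, and such that s ^ Q = s when s is a p'-element.  The result
   Phi is still onto the product of the Tbar_0 / V_t, because Tbar_0 is finite
   and reduced, so that its Frobenius is bijective.  Moreover ker Phi is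
   contained in ker chi: tr_V (x) ^ Q = tr_V (x ^ Q) depends only on the p'-part
   of \sum_s (s x_s) ^ Q, and tr_V (t z) vanishes for z in V_t.  Hence
   ker Phi = ker chi, and comparing cardinals gives r.

   Tbar is finite because [L : K] <= |G| (Artin), so that any |G| + 1 elements
   of Tbar are linearly dependent over k. *)

Set Implicit Arguments.
Unset Strict Implicit.
Unset Printing Implicit Defensive.

Import GRing.Theory.
Local Open Scope classical_set_scope.
Local Open Scope ring_scope.

(** * Trace functions and Frobenius *)

Definition tracelike (A : pzRingType) (U : zmodType) (f : A -> U) : Prop :=
  {morph f : x y / x + y} /\ forall x y, f (x * y) = f (y * x).

Section Tracelike.
Variables (A : pzRingType) (U : zmodType) (f : A -> U).
Hypothesis tr_f : tracelike f.

Lemma tracelikeD x y : f (x + y) = f x + f y. Proof. by case: tr_f. Qed.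

Lemma tracelike0 : f 0 = 0.
Proof. by apply: (addrI (f 0)); rewrite -tracelikeD !addr0. Qed.

Lemma tracelikeN x : f (- x) = - f x.
Proof. by apply: (addrI (f x)); rewrite -tracelikeD !subrr tracelike0. Qed.

Lemma tracelikeB x y : f (x - y) = f x - f y.
Proof. by rewrite tracelikeD tracelikeN. Qed.

Lemma tracelikeC x y : f (x * y) = f (y * x). Proof. by case: tr_f. Qed.

Lemma tracelike_sum (I : Type) (r : seq I) (P : pred I) (F : I -> A) :
  f (\sum_(i <- r | P i) F i) = \sum_(i <- r | P i) f (F i).
Proof. exact: (big_morph f tracelikeD tracelike0). Qed.

Lemma tracelikeMn x n : f (x *+ n) = f x *+ n.
Proof.
by elim: n => [|n IHn]; rewrite ?mulr0n ?tracelike0 // !mulrS tracelikeD IHn.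
Qed.

End Tracelike.

(** The Leibniz rule for a [q] that need not commute with its derivative; a trace function makes all
    the summands equal. *)
Lemma deriv_exp_noncomm (R : nzRingType) (q : {poly R}) n :
  (q ^+ n)^`() = \sum_(i < n) q ^+ i * q^`() * q ^+ (n - i.+1).
Proof.
elim: n => [|n IHn]; first by rewrite big_ord0 expr0 derivC.
rewrite exprSr derivM IHn big_ord_recr /= subnn expr0 mulr1; congr (_ + _).
rewrite mulr_suml; apply: eq_bigr => i _.
by rewrite -mulrA -exprSr subSS -subSn.
Qed.

Section Frobenius.
Variables (U : zmodType) (p : nat).
Hypotheses (p_pr : prime p) (pU : forall u : U, u *+ p = 0).

Lemma mulrn_coprime_eq0 (u : U) i : (0 < i < p)%N -> u *+ i = 0 -> u = 0.
Proof.
move=> /andP[i0 ip] ui.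
have : coprime i p by rewrite coprime_sym prime_coprime // gtnNdvd.
case: (egcdnP p i0) => km kn def_d _ /eqP cop.
have : u *+ (km * i) = u *+ (kn * p + gcdn i p) by rewrite def_d.
by rewrite cop mulrnDr mulnC !mulrnA ui mul0rn mulrnAC pU mul0rn add0r mulr1n.
Qed.

(** The power (x + y)^p is the value at 1 of Z^p with Z = x X + y and X central. The extreme
    coefficients of Z^p are x^p and y^p, and [f] kills the others. For products, (x y)^p and (y x)^p
    differ by a cyclic shift. *)
Let Frobenius_nz (A : nzRingType) (f : A -> U) :
  tracelike f -> tracelike (fun x => f (x ^+ p)).
Proof.
move=> tr_f; split; last first.
  move=> x y; rewrite -(prednK (prime_gt0 p_pr)).
  have -> : (x * y) ^+ p.-1.+1 = x * ((y * x) ^+ p.-1 * y).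
    elim: p.-1 => [|n IHn]; first by rewrite expr1 expr0 mul1r.
    by rewrite exprS IHn exprS !mulrA.
  by rewrite (tracelikeC tr_f) -mulrA -exprSr.
move=> x y; set Z : {poly A} := x%:P * 'X + y%:P.
have sZ n : (size (Z ^+ n) <= n.+1)%N.
  elim: n => [|n IHn]; first by rewrite expr0 size_poly1.
  rewrite exprS; apply: leq_trans (size_polyMleq _ _) _.
  have sz2 : (size Z <= 2)%N.
    apply: leq_trans (size_polyD _ _) _; rewrite geq_max.
    rewrite (leq_trans (size_polyC_leq1 y)) // andbT.
    apply: leq_trans (size_polyMleq _ _) _.
    by rewrite size_polyX addn2 /= ltnS size_polyC_leq1.
  by move: (leq_add sz2 IHn); case: (size Z + _)%N.
have Z1 n : (x + y) ^+ n = \sum_(i < n.+1) (Z ^+ n)`_i.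
  have -> : x + y = Z.[1].
    by rewrite hornerD hornerMX !hornerC mulr1.
  rewrite -horner_exp_comm; last by rewrite /comm_poly mulr1 mul1r.
  rewrite (horner_coef_wide _ (sZ n)).
  by apply: eq_bigr => i _; rewrite expr1n mulr1.
have Z0 n : (Z ^+ n)`_0 = y ^+ n.
  elim: n => [|n IHn]; first by rewrite !expr0 coefC.
  by rewrite !exprS coef0M IHn /Z coefD coefMX !coefC /= add0r.
have Zn n : (Z ^+ n)`_n = x ^+ n.
  elim: n => [|n IHn]; first by rewrite !expr0 coefC.
  rewrite exprS {1}/Z mulrDl coefD -mulrA -commr_polyX mulrA coefMX /= !coefCM IHn.
  by rewrite [(Z ^+ n)`_n.+1]nth_default ?mulr0 ?addr0 ?exprS.
have trC (P Q : {poly A}) i : f (P * Q)`_i = f (Q * P)`_i.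
  rewrite coefM coefMr !(tracelike_sum tr_f); apply: eq_bigr => j _.
  exact: (tracelikeC tr_f).
(* The trace of a coefficient of the derivative of Z ^ p is p times that of
   Z ^ (p - 1) * Z', hence 0. *)
have mid i : (0 < i < p)%N -> f (Z ^+ p)`_i = 0.
  move=> i_p; apply: (mulrn_coprime_eq0 i_p).
  case: i i_p => // i _; rewrite -(tracelikeMn tr_f) -coef_deriv deriv_exp_noncomm.
  rewrite coef_sum (tracelike_sum tr_f).
  rewrite (eq_bigr (fun=> f (Z ^+ p.-1 * Z^`())`_i)).
    by rewrite sumr_const card_ord pU.
  move=> j _; rewrite trC mulrA -exprD; congr (f (Z ^+ _ * _)`__).
  by have := ltn_ord j; lia.
rewrite Z1 -(prednK (prime_gt0 p_pr)) big_ord_recl big_ord_recr /= /bump !add1n.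
rewrite (prednK (prime_gt0 p_pr)) !(tracelikeD tr_f) (tracelike_sum tr_f) big1.
  by rewrite add0r Z0 Zn addrC.
move=> i _; apply: mid; have := ltn_ord i; have := prime_gt0 p_pr.
rewrite /= /bump; lia.
Qed.

(** The zero ring is treated apart, as the polynomial argument needs 1 to be nonzero. *)
Lemma tracelike_Frobenius (A : pzRingType) (f : A -> U) :
  tracelike f -> tracelike (fun x => f (x ^+ p)).
Proof.
move=> tr_f; have [A1|A1] := eqVneq (1 : A) 0.
  have A0 (x y : A) : x = y by rewrite -[x]mulr1 -[y]mulr1 A1 !mulr0.
  split=> [x y|x y]; last by congr f; exact: A0.
  rewrite -(tracelikeD tr_f); congr f; exact: A0.
pose A' : nzRingType := HB.pack A (GRing.PzSemiRing_isNonZero.Build A A1).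
exact: (@Frobenius_nz A').
Qed.

Lemma tracelike_iter_Frobenius (A : pzRingType) (f : A -> U) n :
  tracelike f -> tracelike (fun x => f (x ^+ (p ^ n))).
Proof.
move=> tr_f; elim: n => [|n IHn]; first by rewrite expn0.
have [fD fM] := tracelike_Frobenius IHn.
by split=> [x y|x y]; rewrite expnS !exprM; [exact: fD | exact: fM].
Qed.

End Frobenius.

Section TracelikeMatrix.
Variables (R : comNzRingType) (n : nat).
Local Notation M := 'M[R]_n.+1.

Lemma mxtrace_tracelike : tracelike (fun B : M => \tr B).
Proof. by split=> [B C|B C]; [rewrite mxtraceD | rewrite mxtrace_mulC]. Qed.

(** Each c E_ij is the product of c E_i0 and E_0j, and the product in the other order is c E_00 if i
    = j and 0 otherwise. *)
Lemma tracelike_mxtrace (U : zmodType) (f : M -> U) (B : M) :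
  tracelike f -> f B = f (\tr B *: delta_mx 0 0).
Proof.
move=> tr_f; rewrite {1}[B]matrix_sum_delta (tracelike_sum tr_f).
have off (c : R) i j : f (c *: delta_mx i j) =
    if i == j then f (c *: delta_mx 0 0) else 0.
  have -> : c *: delta_mx i j =
      (c *: delta_mx i 0 : M) * (delta_mx 0 j : M).
    by rewrite -[_ * _]scalemxAl mul_delta_mx.
  rewrite (tracelikeC tr_f) -[_ * _]scalemxAr mul_delta_mx_cond eq_sym.
  by case: eqP; rewrite ?mulr1n // mulr0n scaler0 (tracelike0 tr_f).
rewrite /mxtrace scaler_suml (tracelike_sum tr_f); apply: eq_bigr => i _.
rewrite (tracelike_sum tr_f) (bigD1 i) //= off eqxx big1 ?addr0 // => j ji.
by rewrite off eq_sym (negPf ji).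
Qed.

(** By [tracelike_mxtrace] for the trace function B |-> tr(B^(p^e)), it is enough to treat c E_00,
    and E_00 is idempotent. *)
Lemma mxtrace_Frobenius p e (B : M) : prime p -> p%:R = 0 :> R ->
  \tr (B ^+ (p ^ e)) = \tr B ^+ (p ^ e).
Proof.
move=> p_pr pR.
have pR0 (u : R) : u *+ p = 0 by rewrite -mulr_natr pR mulr0.
have tr_e := tracelike_iter_Frobenius p_pr pR0 e mxtrace_tracelike.
rewrite (tracelike_mxtrace B tr_e).
set c := \tr B; set D : M := delta_mx 0 0.
have DD m : D ^+ m.+1 = D.
  elim: m => [|m IHm]; first exact: expr1.
  by rewrite exprS IHm [D * D]mul_delta_mx.
have -> : (c *: D) ^+ (p ^ e) = c ^+ (p ^ e) *: D ^+ (p ^ e).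
  by rewrite exprZn.
have : (0 < p ^ e)%N by rewrite expn_gt0 prime_gt0.
case: (p ^ e)%N => // m _; rewrite DD mxtraceZ /mxtrace (bigD1 0) //= mxE.
rewrite big1 ?addr0 ?mulr1 // => i /negPf i0.
by rewrite mxE i0.
Qed.

End TracelikeMatrix.

(** * Density *)

(** The size [n.+1] excludes the zero representation. *)
Definition irreducible_rep (k : fieldType) (A : pzRingType) n
    (rho : A -> 'M[k]_n.+1) : Prop :=
  forall v w : 'cV[k]_n.+1, v != 0 -> exists x, rho x *m v = w.

Definition intertwines (k : fieldType) (A : pzRingType) n m
    (rho : A -> 'M[k]_n.+1) (rho' : A -> 'M[k]_m.+1)
    (phi : 'M[k]_(m.+1, n.+1)) : Prop :=
  forall x, rho' x *m phi = phi *m rho x.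

Section Density.
Variables (k : fieldType) (A : pzRingType) (j : k -> A) (r : nat).
Variables (n : 'I_r -> nat) (rho : forall i, {rmorphism A -> 'M[k]_((n i).+1)}).
Hypotheses (rho_j : forall i c, rho i (j c) = c%:M).
Hypothesis irr : forall i, irreducible_rep (rho i).
Hypothesis hom0 : forall i i' phi,
  i != i' -> intertwines (rho i) (rho i') phi -> phi = 0.
Hypothesis end_scalar : forall i phi,
  intertwines (rho i) (rho i) phi -> exists c, phi = c%:M.

Local Notation I := {i : 'I_r & 'I_((n i).+1)}.
Implicit Types (u : I) (l : seq I).

(** An index [u] stands for a basis vector e_s of V_i, so [l] lists basis vectors of the direct sum
    of the V_i. *)
Definition kills l x := forall u, u \in l -> col (tagged u) (rho (tag u) x) = 0.

Lemma killsM l x y : kills l y -> kills l (x * y).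
Proof.
by move=> ky u /ky yu; rewrite rmorphM -[_ * _]/(_ *m _) colE -mulmxA -colE yu mulmx0.
Qed.

Lemma killsB l x y : kills l x -> kills l y -> kills l (x - y).
Proof. by move=> kx ky u ul; rewrite rmorphB linearB /= kx ?ky ?subrr. Qed.

(* When some x0 kills the list l but not the basis vector e_s, the assignment
   x e_s |-> x w, for x killing l, is a well-defined intertwiner, hence it is
   zero or scalar. *)
Lemma kills_span l i (w : 'cV_((n i).+1)) :
    (forall x, kills l x -> rho i x *m w = 0) ->
  forall t, Tagged (fun i => 'I_((n i).+1)) t \notin l -> w t 0 = 0.
Proof.
elim: l => [|[i0 s] l IHl] in i w *.
  move=> w0 t _; have := w0 1; rewrite rmorph1 mul1mx => -> //.
  by rewrite mxE.
move=> lw t; rewrite inE negb_or => /andP[ts tl].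
(* First case: e_s adds no condition, since all that kills [l] kills it too. *)
case: (pselect (forall x, kills l x -> col s (rho i0 x) = 0)) => [ls|].
  apply: IHl (tl) => x lx; apply: lw => u; rewrite inE => /predU1P[-> /=|/lx //].
  exact: ls.
move=> /existsNP[x0 /not_implyP[lx0 /eqP v0]].
set v := col s _ in v0.
(* [b m] carries v = x0 e_s to e_m, so [phi] below is the map e_m |-> b_m x0 w. *)
have b_ex m : exists x, rho i0 x *m v = delta_mx m 0 by exact: irr.
have [b bE] := choice b_ex.
pose phi : 'M_((n i).+1, (n i0).+1) :=
  \matrix_(p, m) (rho i (b m * x0) *m w) p 0.
have phi_col m : col m phi = rho i (b m * x0) *m w.
  by apply/colP=> p; rewrite !mxE.
have phiE x : kills l x -> rho i x *m w = phi *m col s (rho i0 x).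
  (* [y] kills [l] and agrees with [x] on e_s, so x - y kills the longer list and hence w. *)
  move=> lx; set y := \sum_m j (rho i0 x m s) * (b m * x0).
  have ly : kills l y.
    move=> u ul; rewrite /y rmorph_sum linear_sum big1 // => m _.
    exact: (killsM _ (killsM _ lx0)).
  have ys : col s (rho i0 y) = col s (rho i0 x).
    rewrite /y rmorph_sum linear_sum; apply/colP=> p; rewrite summxE (bigD1 p) //=.
    rewrite big1 => [|m mp]; rewrite !rmorphM -![_ * _]/(_ *m _) rho_j colE.
      rewrite -!mulmxA -colE bE mul_scalar_mx !mxE !eqxx mulr1 addr0 //.
    by rewrite -!mulmxA -colE bE mul_scalar_mx !mxE eq_sym (negPf mp) mulr0.
  have /lw : kills ((Tagged (fun i => 'I_((n i).+1)) s) :: l) (x - y).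
    move=> u; rewrite inE => /predU1P[->|]; last exact: killsB.
    by rewrite /= rmorphB linearB /= ys subrr.
  rewrite rmorphB mulmxBl => /eqP; rewrite subr_eq0 => /eqP ->.
  rewrite /y rmorph_sum mulmx_suml; set z := col s _.
  rewrite [z]matrix_sum_delta mulmx_sumr; apply: eq_bigr => m _.
  rewrite big_ord1 -scalemxAr -colE phi_col !rmorphM -![_ * _]/(_ *m _) rho_j.
  by rewrite -!mulmxA mul_scalar_mx /z mxE.
have phi_hom : intertwines (rho i0) (rho i) phi.
  move=> x; apply/matrixP => q m.
  have : col m (rho i x *m phi) = col m (phi *m rho i0 x).
    rewrite ![col m (_ *m _)]colE -!mulmxA -!colE phi_col mulmxA.
    rewrite -[rho i x *m _]/(_ * _) -rmorphM phiE; last exact: (killsM _ (killsM _ lx0)).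
    congr (_ *m _); rewrite !rmorphM -![_ * _]/(_ *m _) colE.
    rewrite -!mulmxA -[_ *m delta_mx s _]colE.
    by rewrite bE -colE.
  by move/colP/(_ q); rewrite mxE => ->; rewrite mxE.
(* If the indices differ, [phi] is zero. Otherwise it is a scalar c, and the induction hypothesis
   applies to w - c e_s, whose entry at t is that of w because t differs from s. *)
have [ii0|ii0] := eqVneq i0 i; last first.
  apply: IHl (tl) => x lx; rewrite phiE // (hom0 ii0 phi_hom) mul0mx //.
move: {bE} phi phi_col phiE phi_hom.
subst i0 => phi _ phiE /end_scalar[c phic].
have s_t : t != s by apply: contraNneq ts => ->.
have := IHl i (w - c *: delta_mx s 0) _ t tl.
rewrite !mxE (negPf s_t) mulr0 subr0; apply=> x lx.
by rewrite mulmxBr phiE // phic mul_scalar_mx -scalemxAr -colE subrr.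
Qed.

(** By [kills_span] some x kills every basis vector but e_s, and irreducibility then moves x e_s to
    w. *)
Lemma separate_basis u (w : 'cV_((n (tag u)).+1)) : exists x,
  col (tagged u) (rho (tag u) x) = w /\
  forall u', u' != u -> col (tagged u') (rho (tag u') x) = 0.
Proof.
case: u w => i s /= w; set u : I := Tagged _ s.
pose l := [seq u' <- enum {: I} | u' != u].
have ul : u \notin l by rewrite mem_filter eqxx.
have : ~ forall x, kills l x -> rho i x *m (delta_mx s 0 : 'cV_((n i).+1)) = 0.
  by move=> h; have /eqP := kills_span h ul; rewrite mxE !eqxx oner_eq0.
move=> /existsNP[x /not_implyP[lx /eqP]] /(irr w)[y yx].
exists (y * x); split; first by rewrite rmorphM -[_ * _]/(_ *m _) colE -mulmxA.
by move=> u' u'u; apply: (killsM y lx); rewrite mem_filter u'u mem_enum.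
Qed.

Lemma density (B : forall i, 'M[k]_((n i).+1)) : exists x, forall i, rho i x = B i.
Proof.
have [x xP] := choice (fun u : I => separate_basis (col (tagged u) (B (tag u)))).
exists (\sum_u x u) => i; apply/matrixP => q s.
set u0 : I := Tagged (fun i => 'I_((n i).+1)) s.
have : col s (rho i (\sum_u x u)) = col s (B i).
  rewrite rmorph_sum linear_sum (bigD1 u0) //= (xP u0).1 big1 ?addr0 // => u uu0.
  by have [_ /(_ u0)] := xP u; apply; rewrite eq_sym.
by move/colP/(_ q); rewrite !mxE.
Qed.

End Density.

(** * Matrices of simple modules *)

Definition spans (k : pzRingType) (M : lmodType k) n (g : 'I_n -> M) : Prop :=
  forall m, exists c : {ffun 'I_n -> k}, m = \sum_i c i *: g i.

Lemma spans_basis (k : fieldType) (M : lmodType k) n (g : 'I_n -> M) :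
  spans g -> exists d (e : 'I_d -> M), is_basis e.
Proof.
elim: n g => [|n IHn] g sp_g.
  exists 0, g => m; have [c mE] := sp_g m; exists c; split=> // c' _.
  by apply/ffunP; case.
have [free|] := pselect (forall c : {ffun 'I_n.+1 -> k},
    \sum_i c i *: g i = 0 -> c = 0).
  exists n.+1, g => m; have [c mE] := sp_g m; exists c; split=> // c' mE'.
  apply/eqP; rewrite -subr_eq0; apply/eqP/free.
  under eq_bigr do rewrite !ffunE scalerDl scaleNr.
  by rewrite big_split sumrN /= -mE -mE' subrr.
move=> /existsNP[c /not_implyP[c0 /eqP c_neq0]].
have [i ci] : exists i, c i != 0.
  apply/existsP; apply: contraNT c_neq0; rewrite negb_exists => /forallP c00.
  by apply/eqP/ffunP=> i; rewrite ffunE; apply/eqP; rewrite -[_ == _]negbK c00.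
apply: (IHn (fun s => g (lift i s))) => m; have [d ->] := sp_g m.
exists [ffun s => d (lift i s) - d i / c i * c (lift i s)].
have gi : g i = - \sum_s (c (lift i s) / c i) *: g (lift i s).
  move: c0; rewrite (bigD1_ord i) //= => /(congr1 (fun v => (c i)^-1 *: v)).
  rewrite scaler0 scalerDr scalerA mulVf // scale1r => /eqP.
  rewrite addr_eq0 => /eqP ->; congr (- _); rewrite scaler_sumr.
  by apply: eq_bigr => s _; rewrite scalerA mulrC.
rewrite (bigD1_ord i) //= gi scalerN scaler_sumr addrC -sumrB.
apply: eq_bigr => s _; rewrite ffunE scalerBl scalerA; congr (_ - _ *: _).
by rewrite mulrCA mulrC -mulrA mulrCA mulrA mulrAC.
Qed.

Definition restrict_scalars (k A : pzRingType) (j : {rmorphism k -> A})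
  (V : lmodType A) : Type := V.

Section RestrictScalars.
Variables (k A : pzRingType) (j : {rmorphism k -> A}) (V : lmodType A).
Local Notation V' := (restrict_scalars j V).

HB.instance Definition _ := GRing.Zmodule.on V'.

Definition restrict_scale (c : k) (v : V') : V' := j c *: (v : V).

Lemma restrict_scaleA c d v :
  restrict_scale c (restrict_scale d v) = restrict_scale (c * d) v.
Proof. by rewrite /restrict_scale rmorphM scalerA. Qed.

Lemma restrict_scale1 : left_id 1 restrict_scale.
Proof. by move=> v; rewrite /restrict_scale rmorph1 scale1r. Qed.

Lemma restrict_scaleDr : right_distributive restrict_scale +%R.
Proof. by move=> c u v; rewrite /restrict_scale scalerDr. Qed.

Lemma restrict_scaleDl v : {morph restrict_scale^~ v : c d / c + d}.
Proof. by move=> c d; rewrite /restrict_scale rmorphD scalerDl. Qed.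

HB.instance Definition _ := GRing.Zmodule_isLmodule.Build k V'
  restrict_scaleA restrict_scale1 restrict_scaleDr restrict_scaleDl.

Lemma restrict_scaleE c (v : V') : c *: v = j c *: (v : V).
Proof. by []. Qed.

End RestrictScalars.

Lemma mulmx_col_inj (R : pzRingType) m n (B C : 'M[R]_(m, n)) :
  (forall w : 'cV_n, B *m w = C *m w) -> B = C.
Proof.
move=> BC; apply/matrixP=> i s; have := BC (delta_mx s 0).
by rewrite -!colE => /colP/(_ i); rewrite !mxE.
Qed.

Lemma simple_gen (A : pzRingType) (V : lmodType A) (v : V) :
  simple_module V -> v != 0 -> forall w, exists x : A, w = x *: v.
Proof.
move=> [_ simV] v0 w; pose U : {pred V} := [pred u | `[< exists x : A, u = x *: v >]].
have U_sub : submod_closed U.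
  split=> [|c _ _ /asboolP[x ->] /asboolP[y ->]]; apply/asboolP.
    by exists 0; rewrite scale0r.
  by exists (c * x + y); rewrite scalerDl scalerA.
have vU : v \in U by apply/asboolP; exists 1; rewrite scale1r.
have [U0|UT] := simV U U_sub; first by move: vU v0; rewrite U0 inE => ->.
by have := UT w; rewrite [RHS]inE => /asboolP.
Qed.

Record module_rep (k A : pzRingType) (j : k -> A) (V : lmodType A) n
    (rho : A -> 'M[k]_n.+1) (b : V -> 'cV[k]_n.+1) : Prop := ModuleRep {
  mrep_bij : bijective b;
  mrepD : {morph b : u v / u + v};
  mrepM : forall x v, b (x *: v) = rho x *m b v;
  mrep_scalar : forall c, rho (j c) = c%:M }.

Section ModuleRep.
Variables (k : finFieldType) (A : pzRingType) (j : {rmorphism k -> A}).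
Hypothesis j_central : forall c x, j c * x = x * j c.
Variables (m : nat) (g : 'I_m -> A).
Hypothesis g_span : forall x, exists c : 'I_m -> k, x = \sum_i j (c i) * g i.

(** For any nonzero v0 the finitely many g_i v0 span V over k, because A v0 = V. Centrality of [j]
    makes the action k-linear. *)
Lemma simple_module_rep (V : lmodType A) : simple_module V ->
  exists n (rho : {rmorphism A -> 'M[k]_n.+1}) b, module_rep j (V := V) rho b.
Proof.
move=> simV; have [v0 v0_neq0] := simV.1.
pose V' := restrict_scalars j V.
have /spans_basis[d [e e_basis]] : spans (fun i => g i *: v0 : V').
  move=> w; have [x ->] := simple_gen simV v0_neq0 w.
  have [c ->] := g_span x; exists [ffun i => c i].
  by rewrite scaler_suml; apply: eq_bigr => i _; rewrite ffunE restrict_scaleE scalerA.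
have [co coP] := choice e_basis.
have coE v : v = \sum_i co v i *: e i := (coP v).1.
have co_eq v (c : {ffun 'I_d -> k}) : v = \sum_i c i *: e i -> co v = c := (coP v).2 c.
case: d => [|n] in e e_basis co coP coE co_eq *.
  by have := coE v0; rewrite big_ord0 => v00; rewrite v00 eqxx in v0_neq0.
pose b (v : V) : 'cV[k]_n.+1 := \col_i co v i.
pose s (w : 'cV[k]_n.+1) : V := \sum_i w i 0 *: e i.
have bK : cancel b s.
  by move=> v; rewrite [RHS]coE; apply: eq_bigr => i _; rewrite mxE.
have sK : cancel s b.
  move=> w; apply/colP=> i; rewrite mxE (co_eq _ [ffun i => w i 0]) ?ffunE //.
  by apply: eq_bigr => l _; rewrite ffunE.
have bb : bijective b by exists s.
have sD : {morph s : u v / u + v}.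
  move=> u v; rewrite /s -big_split; apply: eq_bigr => i _ /=.
  by rewrite mxE scalerDl.
have bD : {morph b : u v / u + v}.
  by move=> u v; apply: (can_inj sK); rewrite sD !bK.
pose rho x : 'M[k]_n.+1 := \matrix_(i, l) co (x *: (e l : V)) i.
have rhoE x v : b (x *: v) = rho x *m b v.
  apply: (can_inj sK); rewrite bK [in LHS](coE v) scaler_sumr.
  rewrite (eq_bigr (fun l => \sum_i (rho x i l * co v l) *: e i)); last first.
    move=> l _; rewrite restrict_scaleE scalerA -j_central -scalerA.
    rewrite [x *: _]coE -restrict_scaleE scaler_sumr; apply: eq_bigr => i _.
    by rewrite scalerA mxE mulrC.
  rewrite exchange_big; apply: eq_bigr => i _; rewrite mxE scaler_suml.
  by apply: eq_bigr => l _; rewrite !mxE.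
have rho_ext B x : (forall v, b (x *: v) = B *m b v) -> rho x = B.
  by move=> BE; apply: mulmx_col_inj => w; rewrite -[w]sK -rhoE BE.
have rhoB : zmod_morphism rho.
  move=> x y; apply: rho_ext => v; rewrite mulmxBl -!rhoE scalerBl.
  by apply/eqP; rewrite eq_sym subr_eq -bD subrK.
have rhoM : monoid_morphism rho.
  split=> [|x y]; apply: rho_ext => v; first by rewrite scale1r mul1mx.
  by rewrite -[rho x * _]/(_ *m _) -mulmxA -!rhoE scalerA.
pose rho' : {rmorphism A -> 'M[k]_n.+1} := HB.pack rho
  (GRing.isZmodMorphism.Build _ _ rho rhoB)
  (GRing.isMonoidMorphism.Build _ _ rho rhoM).
exists n, rho', b; split=> // c; apply: rho_ext => v.
rewrite mul_scalar_mx; apply: (can_inj sK); rewrite bK [in LHS](coE v) scaler_sumr.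
by apply: eq_bigr => i _; rewrite -restrict_scaleE scalerA !mxE.
Qed.

Section Properties.
Variables (V : lmodType A) (n : nat) (rho : {rmorphism A -> 'M[k]_n.+1}).
Variables (b : V -> 'cV[k]_n.+1).
Hypothesis V_rep : module_rep j rho b.

Lemma mrep0 : b 0 = 0.
Proof. by apply: (addrI (b 0)); rewrite -(mrepD V_rep) !addr0. Qed.

Lemma mrepZ c v : b (j c *: v) = c *: b v.
Proof. by rewrite (mrepM V_rep) (mrep_scalar V_rep) mul_scalar_mx. Qed.

Lemma simple_irreducible : simple_module V -> irreducible_rep rho.
Proof.
move=> simV v w v0; have [s bK sK] := mrep_bij V_rep.
have sv0 : s v != 0 by apply: contraNneq v0 => sv; rewrite -[v]sK sv mrep0.
have [x xE] := simple_gen simV sv0 (s w).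
by exists x; rewrite -[v]sK -(mrepM V_rep) -xE sK.
Qed.

(** Schur's lemma over an algebraic closure E of k: phi has an eigenvalue there, the eigenspace is a
    nonzero stable subspace, and absolute simplicity makes it the whole space. *)
Lemma absolutely_simple_end : absolutely_simple j V ->
  forall phi, intertwines rho rho phi -> exists c, phi = c%:M.
Proof.
move=> [_ absV] phi phiP; have [s bK sK] := mrep_bij V_rep.
have [E [f _]] := countable_algebraic_closure k.
pose iota_fun v : 'cV[E]_n.+1 := map_mx f (b v).
have iotaB : zmod_morphism iota_fun.
  move=> u v; apply/eqP; rewrite eq_sym subr_eq -map_mxD -(mrepD V_rep).
  by rewrite subrK.
pose iota : {additive V -> 'cV[E]_n.+1} := HB.pack iota_fun
  (GRing.isZmodMorphism.Build _ _ iota_fun iotaB).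
pose rhoE x : {linear 'cV[E]_n.+1 -> 'cV[E]_n.+1} := mulmx (map_mx f (rho x)).
have iota_delta i : iota (s (delta_mx i 0)) = delta_mx i 0.
  by rewrite /iota /= /iota_fun sK map_delta_mx.
(* Columns over E realize the scalar extension: a map out of V is extended through its values on the
   basis vectors. *)
have extV : is_scalar_extension j f rhoE iota.
  split=> [c v|x v|X h hZ].
  - by rewrite /iota /= /iota_fun mrepZ map_mxZ.
  - by rewrite /iota /= /iota_fun (mrepM V_rep) map_mxM.
  split; last first.
    move=> h1 h2 h12 w; rewrite [w]matrix_sum_delta !linear_sum.
    apply: eq_bigr => i _; rewrite !linear_sum; apply: eq_bigr => l _.
    by rewrite !linearZ /= [l]ord1 -iota_delta h12.
  pose H_fun (w : 'cV[E]_n.+1) : X := \sum_i w i 0 *: h (s (delta_mx i 0)).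
  have H_lin : linear H_fun.
    move=> c u v; rewrite /H_fun scaler_sumr -big_split; apply: eq_bigr => i _ /=.
    by rewrite !mxE scalerDl scalerA.
  pose H : {linear 'cV[E]_n.+1 -> X} := HB.pack H_fun
    (GRing.isLinear.Build _ _ _ _ H_fun H_lin).
  exists H => v; rewrite /H /= /H_fun.
  have vE : v = \sum_i j (b v i 0) *: s (delta_mx i 0).
    apply: (can_inj bK); rewrite (big_morph b (mrepD V_rep) mrep0).
    rewrite [LHS]matrix_sum_delta; apply: eq_bigr => i _.
    by rewrite big_ord1 mrepZ sK.
  rewrite [in RHS]vE raddf_sum; apply: eq_bigr => i _.
  by rewrite hZ /iota /= /iota_fun mxE.
(* [eigenvalue] refers to row vectors, hence the transpose. *)
have [lam /eigenvalueP[v vE v_neq0]] :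
    exists lam, eigenvalue (map_mx f phi)^T lam.
  have /closed_rootP[lam] : size (char_poly (map_mx f phi)^T) != 1%N.
    by rewrite size_char_poly.
  by rewrite -eigenvalue_root_char; exists lam.
pose U : {pred 'cV[E]_n.+1} := [pred w | map_mx f phi *m w == lam *: w].
have U_sub : submod_closed U.
  split=> [|c u w]; first by rewrite inE mulmx0 scaler0.
  rewrite !inE mulmxDr -scalemxAr => /eqP -> /eqP ->.
  by rewrite scalerDr !scalerA mulrC.
have vU : v^T \in U.
  by rewrite inE -[map_mx f phi]trmxK -trmx_mul vE linearZ.
have [|U0|UT] := (absV E f _ rhoE iota extV).2 U U_sub.
- move=> x w; rewrite !inE /= => /eqP phiw.
  by rewrite mulmxA -map_mxM -phiP map_mxM -mulmxA phiw scalemxAr.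
- by move: vU v_neq0; rewrite U0 inE -[0]trmx0 (inj_eq trmx_inj) => ->.
have phi_lam : map_mx f phi = lam%:M.
  apply: mulmx_col_inj => w; have := UT w; rewrite !inE => /eqP ->.
  by rewrite mul_scalar_mx.
(* The eigenvalue comes from k, being the image of an entry of phi. *)
exists (phi 0 0); apply/matrixP => i l; apply: (fmorph_inj f).
have := congr1 (fun B : 'M_n.+1 => B i l) phi_lam.
have := congr1 (fun B : 'M_n.+1 => B 0 0) phi_lam.
by rewrite !mxE eqxx rmorphMn mulr1n => <-.
Qed.

End Properties.

(** Schur's lemma: the kernel is a submodule other than V, hence zero, and any nonzero value
    generates V'. *)
Lemma intertwiner_isomorphic (V V' : lmodType A) n n'
    (rho : {rmorphism A -> 'M[k]_n.+1}) (rho' : {rmorphism A -> 'M[k]_n'.+1})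
    (b : V -> 'cV[k]_n.+1) (b' : V' -> 'cV[k]_n'.+1) phi :
    module_rep j rho b -> module_rep j rho' b' ->
    simple_module V -> simple_module V' ->
  intertwines rho rho' phi -> phi != 0 -> isomorphic V V'.
Proof.
move=> rV rV' simV simV' phiP phi_neq0.
have [s bK sK] := mrep_bij rV; have [s' bK' sK'] := mrep_bij rV'.
pose h_fun v : V' := s' (phi *m b v).
have hE v : b' (h_fun v) = phi *m b v by rewrite sK'.
have h_lin : linear h_fun.
  move=> c u v; apply: (can_inj bK'); rewrite hE (mrepD rV) (mrepD rV').
  by rewrite (mrepM rV) (mrepM rV') !hE mulmxDr !mulmxA phiP.
pose h : {linear V -> V'} := HB.pack h_fun (GRing.isLinear.Build _ _ _ _ h_fun h_lin).
have phi0 : phi <> 0 by apply/eqP.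
have [w phiw] : exists w : 'cV[k]_n.+1, phi *m w != 0.
  apply: contrapT => no_w; apply: phi0; apply: mulmx_col_inj => w.
  by rewrite mul0mx; apply: contrapT => /eqP phiw; apply: no_w; exists w.
exists h; suff [inj_h surj_h] : injective h /\ forall v', exists v, h v = v'.
  have [h' hK'] := choice surj_h.
  by exists h' => // v; apply: inj_h; rewrite hK'.
split; last first.
  move=> v'; have hw : h (s w) != 0.
    apply: contraNneq phiw => hsw; have := hE (s w).
    by rewrite sK -[h_fun _]/(h _) hsw (mrep0 rV') => <-.
  have [x ->] := simple_gen simV' hw v'.
  by exists (x *: s w); rewrite linearZ.
pose U : {pred V} := [pred v | h v == 0].
have U_sub : submod_closed U.
  split=> [|c u v]; rewrite !inE ?linear0 // => /eqP hu /eqP hv.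
  by rewrite linearP hu hv scaler0 addr0.
have [U0|UT] := simV.2 U U_sub.
  move=> u v huv; apply/eqP; rewrite -subr_eq0.
  by have := U0 (u - v); rewrite !inE linearB huv subrr eqxx => <-.
have := UT (s w); rewrite !inE => /eqP hsw.
by move: phiw; rewrite -[w]sK -hE -[h_fun _]/(h _) hsw (mrep0 rV') eqxx.
Qed.

End ModuleRep.

(** * Counting simple modules *)

Section FiniteCover.
Variables (F : finType) (T : Type) (s : F -> T).
Hypothesis s_surj : forall t, exists c, t = s c.

(** The pigeonhole principle for [#|F|] + 1 values. Finiteness of T is expressed by a surjection
    from a finite type. *)
Lemma cover_repeat (u : nat -> T) : exists i l, (i < l <= #|F|)%N /\ u i = u l.
Proof.
have [c sc] := choice s_surj.
pose v (i : 'I_#|F|.+1) := c (u i).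
have /injectivePn[i [l il vil]] : ~~ injectiveb v.
  by apply/injectiveP => /leq_card; rewrite card_ord ltnn.
have uil : u i = u l by rewrite (sc (u i)) (sc (u l)) -/(v i) vil.
have i_le := ltn_ord i; have l_le := ltn_ord l.
have := il; rewrite -val_eqE neq_ltn => /orP[lt_il|lt_li].
  by exists i, l; split=> //; rewrite lt_il -ltnS l_le.
by exists l, i; split=> //; rewrite lt_li -ltnS i_le.
Qed.

(** The iterates of y repeat, and cancelling f shows that y itself recurs later. *)
Lemma cover_inj_surj (f : T -> T) : injective f -> forall y, exists x, y = f x.
Proof.
move=> inj_f y; have [i [l [/andP[il _]]]] := cover_repeat (fun n => iter n f y).
elim: i l il => [|i IHi] [//|l] il /=; last by move/inj_f/IHi; apply.
by move=> ->; exists (iter l f y).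
Qed.

End FiniteCover.

Lemma isomorphic_sym (A : pzRingType) (V W : lmodType A) :
  isomorphic V W -> isomorphic W V.
Proof.
move=> [f [g fK gK]].
have g_lin : linear g.
  by move=> c u v; apply: (can_inj fK); rewrite gK linearP !gK.
pose g' : {linear W -> V} := HB.pack g (GRing.isLinear.Build _ _ _ _ g g_lin).
by exists g', f.
Qed.

(** * Maximal left ideals and elements that kill all simple modules *)

Section SimpleQuotient.
Variables (A : pzRingType) (F : finType) (s : F -> A).
Hypothesis s_surj : forall t, exists c, t = s c.

(** Among the proper left ideals above L, take one with the most preimages in [F]. *)
Lemma maximal_left_ideal (L : {pred A^o}) :
    submod_closed L -> 1 \notin L ->
  exists M : {pred A^o}, [/\ submod_closed M, 1 \notin M, {subset L <= M} &
    forall U : {pred A^o}, submod_closed U -> 1 \notin U -> {subset M <= U} ->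
      {subset U <= M}].
Proof.
move=> L_sub L1.
pose sz (M : {pred A^o}) := #|[pred c | s c \in M]|.
pose good n := exists M : {pred A^o},
  [/\ submod_closed M, 1 \notin M, {subset L <= M} & sz M = n].
have ex_n : exists n, `[< good n >].
  exists (sz L); apply/asboolP; exists L; split=> //.

have ub n : `[< good n >] -> (n <= #|F|)%N.
  by move=> /asboolP[M [_ _ _ <-]]; exact: max_card.
case: (ex_maxnP ex_n ub) => n /asboolP[M [M_sub M1 LM Mn]] n_max.
exists M; split=> // U U_sub U1 MU x xU.
have [c xE] := s_surj x; rewrite xE in xU *.
have subMU : [pred c | s c \in M] \subset [pred c | s c \in U].
  by apply/fintype.subsetP => d; rewrite !inE => /MU.
have : (sz U <= sz M)%N.
  rewrite Mn; apply: n_max; apply/asboolP; exists U; split=> //.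
  by move=> y /LM/MU.
by rewrite (geq_leqif (subset_leqif_card subMU)) => /fintype.subsetP/(_ c); apply.
Qed.

Lemma mquot_simple (M : {pred A^o}) (M_sub : submod_closed M) :
    1 \notin M ->
    (forall U : {pred A^o}, submod_closed U -> 1 \notin U -> {subset M <= U} ->
      {subset U <= M}) ->
  simple_module (mquot M_sub).
Proof.
move=> M1 M_max; have mpi0 : @Defs.mpi _ _ _ M_sub 0 = 0.
  by apply: (addrI (@Defs.mpi _ _ _ M_sub 0)); rewrite -Defs.mpiD !addr0.
split.
  exists (@Defs.mpi _ _ _ M_sub 1); apply: contraNneq M1 => h.
  by rewrite -[1]subr0; apply/(Defs.mpi_eq M_sub); rewrite mpi0 h.
move=> U [U0 UP]; pose W : {pred A^o} := [pred a | @Defs.mpi _ _ _ M_sub a \in U].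
have W_sub : submod_closed W.
  split=> [|c u v]; rewrite !inE ?mpi0 // => uW vW.
  by rewrite Defs.mpiD Defs.mpiZ; apply: UP.
have [W1|W1] := boolP (1 \in W).
  right=> v; rewrite -[v]mreprK [RHS]inE.
  have [_ /(_ (mrepr v) 1 0)] := W_sub.
  by rewrite addr0 [_ *: _]mulr1 => /(_ W1); apply; case: W_sub.
left=> v; rewrite -[v]mreprK [RHS]inE; apply/idP/eqP => [vU|->]; last by [].
rewrite -mpi0; apply/(Defs.mpi_eq M_sub); rewrite subr0; apply: (M_max W) => //.
move=> a aM; rewrite inE; suff -> : @Defs.mpi _ _ _ M_sub a = 0 by [].
by rewrite -mpi0; apply/(Defs.mpi_eq M_sub); rewrite subr0.
Qed.

(** Otherwise A (1 - x) lies in a maximal left ideal M; as x kills A / M, also x lies in M, and then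
    so does 1. *)
Lemma kills_simple_left_unit (x : A) :
    (forall V : lmodType A, simple_module V -> forall v : V, x *: v = 0) ->
  exists z, z * (1 - x) = 1.
Proof.
move=> x_kills; apply: contrapT => no_z.
pose L : {pred A^o} := [pred a | `[< exists z, z * (1 - x) = a >]].
have L_sub : submod_closed L.
  split=> [|c _ _ /asboolP[y <-] /asboolP[z <-]]; apply/asboolP.
    by exists 0; rewrite mul0r.
  by exists (c * y + z); rewrite mulrDl -mulrA.
have L1 : 1 \notin L by apply/asboolP.
have [M [M_sub M1 LM M_max]] := maximal_left_ideal L_sub L1.
have := x_kills _ (mquot_simple M_sub M1 M_max) (@Defs.mpi _ _ _ M_sub 1).
have x1 : x *: (1 : A^o) = x by exact: mulr1.
rewrite -[LHS]Defs.mpiZ x1 => x0.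
have mpi0 : @Defs.mpi _ _ _ M_sub 0 = 0.
  by apply: (addrI (@Defs.mpi _ _ _ M_sub 0)); rewrite -Defs.mpiD !addr0.
have xM : x \in M by rewrite -[x]subr0; apply/(Defs.mpi_eq M_sub); rewrite x0 mpi0.
have : 1 - x \in M by apply: LM; apply/asboolP; exists 1; rewrite mul1r.
have [_ /(_ 1 (1 - x) x) h] := M_sub; move=> /h/(_ xM).
by rewrite scale1r subrK (negPf M1).
Qed.

(** Two powers agree, x^i = x^l with i < l, so (1 - x^(l - i)) x^i = 0, where the first factor has a
    left inverse. *)
Lemma kills_simple_nilpotent (x : A) :
    (forall V : lmodType A, simple_module V -> forall v : V, x *: v = 0) ->
  exists n, (n <= #|F|)%N /\ x ^+ n = 0.
Proof.
move=> x_kills; have [i [l [/andP[il lF] xil]]] := cover_repeat s_surj (GRing.exp x).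
exists i; split; first by lia.
have [|z zE] := @kills_simple_left_unit (x ^+ (l - i)).
  move=> V simV v; rewrite -(subnSK il) exprS -scalerA; exact: x_kills.
have x0 : (1 - x ^+ (l - i)) * x ^+ i = 0.
  by rewrite mulrBl -exprD subnK ?mul1r ?xil ?subrr // ltnW.
by rewrite -[LHS]mul1r -[X in X * _]zE -mulrA x0 mulr0.
Qed.

End SimpleQuotient.

(** * The number of simple modules from a trace function *)

Section CountSimple.
Variables (k : finFieldType) (A : pzRingType) (j : {rmorphism k -> A}).
Hypothesis j_central : forall c x, j c * x = x * j c.
Variables (m : nat) (g : 'I_m -> A).
Hypothesis g_span : forall x, exists c : 'I_m -> k, x = \sum_i j (c i) * g i.
Hypothesis split_A : forall V : lmodType A, simple_module V -> absolutely_simple j V.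
Variables (I : finType) (Phi : A -> {ffun I -> k}).
Hypothesis Phi_tr : tracelike Phi.
Hypothesis Phi_surj : forall u, exists x, Phi x = u.
Hypothesis Phi_nilpotent : forall x n, x ^+ n = 0 -> Phi x = 0.
Hypothesis Phi_ker : forall n (rho : {rmorphism A -> 'M[k]_n.+1}),
  irreducible_rep rho -> (forall c, rho (j c) = c%:M) ->
  forall x, Phi x = 0 -> \tr (rho x) = 0.

Section Family.
Variables (r : nat) (M : 'I_r -> lmodType A) (n : 'I_r -> nat).
Variables (rho : forall i, {rmorphism A -> 'M[k]_((n i).+1)}).
Variables (b : forall i, M i -> 'cV[k]_((n i).+1)).
Arguments b : clear implicits.
Hypothesis M_rep : forall i, module_rep j (rho i) (b i).
Hypothesis M_simple : forall i, simple_module (M i).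
Hypothesis M_noniso : forall i l, isomorphic (M i) (M l) -> i = l.

Lemma family_density (B : forall i, 'M[k]_((n i).+1)) :
  exists x, forall i, rho i x = B i.
Proof.
apply: (density (fun i => mrep_scalar (M_rep i))).
- by move=> i; apply: simple_irreducible (M_rep i) (M_simple i).
- move=> i l phi il phiP; apply/eqP; apply: contraNT il => phi0; apply/eqP.
  apply: M_noniso.
  exact: (intertwiner_isomorphic (M_rep i) (M_rep l) (M_simple i) (M_simple l) phiP).
- by move=> i; apply: absolutely_simple_end (M_rep i) (split_A (M_simple i)).
Qed.

Let chi x : {ffun 'I_r -> k} := [ffun i => \tr (rho i x)].

Let chi_surj c : exists x, chi x = c.
Proof.
have [x xE] := family_density (fun i => c i *: delta_mx 0 0).
exists x; apply/ffunP => i; rewrite ffunE xE mxtraceZ /mxtrace (bigD1 0) //= mxE.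
rewrite big1 ?addr0 ?mulr1 // => l /negPf l0; by rewrite mxE l0.
Qed.

Let chiB x y : chi (x - y) = chi x - chi y.
Proof. by apply/ffunP => i; rewrite !ffunE rmorphB /= linearB. Qed.

Let Phi_chi x : Phi x = 0 -> chi x = 0.
Proof.
move=> Phix; apply/ffunP => i; rewrite !ffunE; apply: Phi_ker Phix.
  exact: simple_irreducible (M_rep i) (M_simple i).
exact: mrep_scalar (M_rep i).
Qed.

(** [chi] maps onto k^r and vanishes on the kernel of [Phi]. Cardinals are compared in place of
    dimensions because [Phi] is only assumed additive. *)
Lemma family_size_le : (r <= #|I|)%N.
Proof.
have [x xE] := choice chi_surj.
have inj : injective (Phi \o x).
  move=> c d /eqP; rewrite /= -subr_eq0 -(tracelikeB Phi_tr) => /eqP/Phi_chi/eqP.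
  by rewrite chiB subr_eq0 !xE => /eqP.
have := leq_card _ inj; rewrite !card_ffun card_ord leq_exp2l //.
exact: card_finNzRing_gt1.
Qed.

Hypothesis M_complete : forall V : lmodType A, simple_module V ->
  exists i, isomorphic V (M i).

Let nilpotent_kernel x : (forall i, rho i x = 0) -> Phi x = 0.
Proof.
move=> rx; have cover : forall a, exists c : {ffun 'I_m -> k},
    a = \sum_i j (c i) * g i.
  move=> a; have [c ->] := g_span a; exists [ffun i => c i].
  by apply: eq_bigr => i _; rewrite ffunE.
have [|e [_ xe]] := kills_simple_nilpotent cover (x := x).
  move=> V /M_complete[i [h [h' hK h'K]]] v.
  have [s bK sK] := mrep_bij (M_rep i).
  apply: (can_inj hK); rewrite linearZ linear0 /=; apply: (can_inj bK).
  by rewrite (mrepM (M_rep i)) rx mul0mx (mrep0 (M_rep i)).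
exact: Phi_nilpotent xe.
Qed.

Let Phi_eq x y : (forall i, rho i x = rho i y) -> Phi x = Phi y.
Proof.
move=> xy; apply/eqP; rewrite -subr_eq0 -(tracelikeB Phi_tr); apply/eqP.
by apply: nilpotent_kernel => i; rewrite rmorphB xy subrr.
Qed.

(** [Phi] depends only on the matrices [rho i x], so it induces a trace function on each matrix
    algebra, and such a function depends only on the trace. *)
Let chi_Phi x : chi x = 0 -> Phi x = 0.
Proof.
move=> chi0.
have single_ex i (B : 'M[k]_((n i).+1)) :
    exists y, rho i y = B /\ forall l, l != i -> rho l y = 0.
  (* [inord] only reconciles the sizes [n i] and [n l]; for l = i it is the identity. *)
  have [y yE] := family_density
    (fun l => if l == i then \matrix_(q, t) B (inord q) (inord t) else 0).
  exists y; split=> [|l /negPf li]; last by rewrite yE li.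
  by rewrite yE eqxx; apply/matrixP => q t; rewrite mxE !inord_val.
pose lift i := projT1 (choice (single_ex i)).
have liftP i B : rho i (lift i B) = B /\ forall l, l != i -> rho l (lift i B) = 0.
  exact: (projT2 (choice (single_ex i))).
have lift_eq i B y : rho i y = B -> (forall l, l != i -> rho l y = 0) ->
    Phi y = Phi (lift i B).
  move=> yB y0; have [lB l0] := liftP i B; apply: Phi_eq => l.
  by have [->|li] := eqVneq l i; [rewrite yB lB | rewrite y0 // l0].
have tr_i i : tracelike (fun B => Phi (lift i B)).
  split=> [B C|B C]; have [B1 B0] := liftP i B; have [C1 C0] := liftP i C.
    rewrite -(tracelikeD Phi_tr); apply/esym/lift_eq => [|l li].
      by rewrite rmorphD B1 C1.
    by rewrite rmorphD B0 // C0 // addr0.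
  rewrite -(lift_eq i _ (lift i B * lift i C)).
  - rewrite (tracelikeC Phi_tr); apply: lift_eq => [|l li]; first by rewrite rmorphM B1 C1.
    by rewrite rmorphM B0 // mulr0.
  - by rewrite rmorphM B1 C1.
  by move=> l li; rewrite rmorphM B0 // mul0r.
have -> : Phi x = Phi (\sum_i lift i (rho i x)).
  apply: Phi_eq => l; rewrite rmorph_sum (bigD1 l) //= big1 ?addr0.
    by have [-> _] := liftP l (rho l x).
  by move=> i il; have [_ ->] := liftP i (rho i x); rewrite // eq_sym.
rewrite (tracelike_sum Phi_tr) big1 // => i _.
rewrite (tracelike_mxtrace _ (tr_i i)).
have := congr1 (fun f : {ffun _ -> k} => f i) chi0; rewrite /chi !ffunE => ->.
rewrite scale0r -(lift_eq i 0 0) ?rmorph0 ?(tracelike0 Phi_tr) // => l _.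
by rewrite rmorph0.
Qed.

(** The count of [family_size_le] with the roles of [chi] and [Phi] exchanged, which completeness of
    the family allows. *)
Lemma family_size_ge : (#|I| <= r)%N.
Proof.
have [x xE] := choice Phi_surj.
have inj : injective (chi \o x).
  move=> c d /eqP; rewrite /= -subr_eq0 -chiB => /eqP/chi_Phi/eqP.
  by rewrite (tracelikeB Phi_tr) subr_eq0 !xE => /eqP.
have := leq_card _ inj; rewrite !card_ffun card_ord leq_exp2l //.
exact: card_finNzRing_gt1.
Qed.

End Family.

Lemma family_reps r (M : 'I_r -> lmodType A) : (forall i, simple_module (M i)) ->
  exists (n : 'I_r -> nat) (rho : forall i, {rmorphism A -> 'M[k]_((n i).+1)})
    (b : forall i, M i -> 'cV[k]_((n i).+1)), forall i, module_rep j (rho i) (b i).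
Proof.
move=> simM.
pose R i := {n : nat & {rho : {rmorphism A -> 'M[k]_n.+1} &
  {b : M i -> 'cV[k]_n.+1 | module_rep j rho b}}}.
have rep i : R i.
  have [n /cid[rho /cid[b repb]]] := cid (simple_module_rep j_central g_span (simM i)).
  by exists n, rho, b.
exists (fun i => projT1 (rep i)), (fun i => projT1 (projT2 (rep i))).
exists (fun i => sval (projT2 (projT2 (rep i)))) => i.
exact: (svalP (projT2 (projT2 (rep i)))).
Qed.

Let is_family r (M : 'I_r -> lmodType A) :=
  (forall i, simple_module (M i)) /\ (forall i l, isomorphic (M i) (M l) -> i = l).

(** A largest family of pairwise nonisomorphic simple modules exists because the size is bounded; it
    is complete, since otherwise one more module could be added. *)
Theorem num_simple_modules_tracelike : num_simple_modules A #|I|.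
Proof.
pose P r := `[< exists M : 'I_r -> lmodType A, is_family M >].
have P0 : exists r, P r.
  exists 0%N; apply/asboolP.
  exists (fun i : 'I_0 => match notF (ltn_ord i) return lmodType A with end).
  by split; case.
have P_le r : P r -> (r <= #|I|)%N.
  move=> /asboolP[M [simM isoM]]; have [n [rho [b rep_b]]] := family_reps simM.
  exact: (family_size_le rep_b simM isoM).
case: (ex_maxnP P0 P_le) => r /asboolP[M [simM isoM]] r_max.
have complM V : simple_module V -> exists i, isomorphic V (M i).
  move=> simV; apply: contrapT => no_i.
  pose M' i := if unlift ord0 i is Some i' then M i' else V.
  suff /r_max : P r.+1 by rewrite ltnn.
  apply/asboolP; exists M'; split=> [i|i l]; rewrite /M'.
    by case: unliftP.
  case: unliftP => [i' ->|->]; case: unliftP => [l' ->|->] //.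
  - by move/isoM->.
  - by move/isomorphic_sym => h; case: no_i; exists i'.
  - by move=> h; case: no_i; exists l'.
have [n [rho [b rep_b]]] := family_reps simM.
have := family_size_ge rep_b simM isoM complM.
have := P_le r; rewrite {1}/P => /(_ (asboolT _)) le1 le2.
have -> : #|I| = r by apply/eqP; rewrite eqn_leq le2 le1 //; exists M.
by exists M; split.
Qed.
End CountSimple.

(** * Finite commutative rings modulo the Jacobson radical *)

Section FiniteCommutative.
Variables (C : comPzRingType) (F : finType) (s : F -> C).
Hypothesis s_surj : forall y, exists c, y = s c.

(** The annihilator of a nonzero v is a maximal ideal. *)
Lemma Jac_kills_simple (V : lmodType C) (v : V) (x : C) :
  simple_module V -> Jac C x -> x *: v = 0.
Proof.
move=> simV Jx; have [->|v0] := eqVneq v 0; first by rewrite scaler0.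
pose ann : C -> Prop := fun a => a *: v = 0.
have ann0 : ann 0 by rewrite /ann scale0r.
have annD a b : ann a -> ann b -> ann (a + b).
  by rewrite /ann scalerDl => -> ->; rewrite addr0.
have annM a b : ann b -> ann (a * b).
  by rewrite /ann -scalerA => ->; rewrite scaler0.
apply: (Jx (Ideal ann0 annD annM)); split=> [/=|J annJ J1 y Jy].
  by rewrite /ann scale1r; apply/eqP.
apply: contrapT => /= /eqP yv; have [z zE] := simple_gen simV yv v.
apply: J1; rewrite -(subrK (z * y) 1); apply: idealD; last exact: idealM.
by apply: annJ; rewrite /= /ann scalerBl scale1r -scalerA -zE subrr.
Qed.

Lemma Jac_nilpotent x : Jac C x -> exists n, x ^+ n = 0.
Proof.
move=> Jx; have [|n [_ xn]] := kills_simple_nilpotent s_surj (x := x).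
  by move=> V simV v; apply: Jac_kills_simple.
by exists n.
Qed.

(** If x is not in M then 1 = m + b x with m in M, so x^n = m x^n + b x^(n+1), and the exponent can
    be lowered. *)
Lemma maximal_ideal_exp (M : ideal C) x n : maximal_ideal M -> M (x ^+ n) -> M x.
Proof.
move=> [M1 M_max] Mxn; apply: contrapT => Mx.
pose J : C -> Prop := fun a => exists m b, M m /\ a = m + b * x.
have J0 : J 0 by exists 0, 0; rewrite mul0r addr0; split=> //; exact: ideal0.
have JD a b : J a -> J b -> J (a + b).
  move=> [m [c [Mm ->]]] [m' [c' [Mm' ->]]]; exists (m + m'), (c + c').
  by rewrite mulrDl addrACA; split=> //; apply: idealD.
have JM a b : J b -> J (a * b).
  move=> [m [c [Mm ->]]]; exists (a * m), (a * c).
  by rewrite mulrDr mulrA; split=> //; apply: idealM.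
have [m [b [Mm E]]] : J 1.
  apply: contrapT => J1; apply: Mx.
  apply: (M_max (Ideal J0 JD JM)) => //= [y My|].
    by exists y, 0; rewrite mul0r addr0.
  by exists 0, 1; rewrite mul1r add0r; split=> //; exact: ideal0.
apply: M1; elim: n Mxn => [|n IHn]; rewrite ?expr0 // exprS => Mxn; apply: IHn.
rewrite -[_ ^+ _]mul1r E mulrDl mulrC -mulrA; apply: idealD; exact: idealM.
Qed.

Local Notation T0 := (rquot (Jac C)).

Lemma Jac_quotient_reduced (y : T0) n : y ^+ n = 0 -> y = 0.
Proof.
rewrite -[y]rreprK -rmorphXn -(rmorph0 (rpi (Jac C))) => /rpi_eq.
rewrite subr0 => Jy; apply/rpi_eq; rewrite subr0 => M maxM.
exact: maximal_ideal_exp (Jy M maxM).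
Qed.

(** The iterated Frobenius map is additive, the identity being a trace function here. Its kernel is
    trivial as the quotient is reduced, so it is injective on a finite set. *)
Lemma Jac_quotient_perfect p e (y : T0) : prime p -> p%:R = 0 :> C ->
  exists z, y = z ^+ (p ^ e).
Proof.
move=> p_pr pC.
have pT (u : T0) : u *+ p = 0.
  by rewrite -[u]rreprK -rmorphMn -mulr_natr pC mulr0 rmorph0.
have id_tr : tracelike (id : T0 -> T0) by split=> // u v; exact: mulrC.
have F_tr := tracelike_iter_Frobenius p_pr pT e id_tr.
have cover u : exists c, u = rpi (Jac C) (s c).
  by have [c cE] := s_surj (rrepr u); exists c; rewrite -cE rreprK.
apply: (cover_inj_surj cover) => u v /eqP; rewrite -subr_eq0 -(tracelikeB F_tr).
by move=> /eqP/Jac_quotient_reduced/eqP; rewrite subr_eq0 => /eqP.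
Qed.

End FiniteCommutative.

(** Write the order of G as p^b m with m prime to p. The exponent e is a multiple of the totient of
    m, so p^e = 1 modulo m, and it is at least b, so the p^e-th power removes p-parts. The summand
    [bound] makes p^e large. *)
Lemma p'_exponent (G : finGroupType) p bound : prime p -> exists e,
  [/\ (bound <= p ^ e)%N, forall s : G, ~~ (p %| #[s ^+ (p ^ e)]%g)%N &
      forall s : G, ~~ (p %| #[s]%g)%N -> (s ^+ (p ^ e) = s)%g].
Proof.
move=> p_pr; have p_gt1 := prime_gt1 p_pr.
have n_gt0 : (0 < #|[set: G]%SET|)%N by apply/card_gt0P; exists 1%g; rewrite finset.in_setT.
set n := #|[set: G]%SET| in n_gt0.
have [m pm nE] := pfactor_coprime p_pr n_gt0.
have m_gt0 : (0 < m)%N by move: n_gt0; rewrite nE; case: (m).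
pose e := (totient m * (logn p n + bound))%N.
have e_ge : (logn p n + bound <= e)%N by rewrite leq_pmull // totient_gt0.
have pe1 : p ^ e = 1 %[mod m].
  by rewrite expnM -modnXm Euler_exp_totient // modnXm exp1n.
have order_dvd (s : G) : ~~ (p %| #[s]%g)%N -> (#[s]%g %| m)%N.
  move=> ps; have : (#[s]%g %| n)%N by exact: (@order_dvdG _ [set: G]%G s (finset.in_setT _)).
  by rewrite nE Gauss_dvdl // coprimeXr // coprime_sym prime_coprime.
exists e; split=> [|s|s ps].
- by have := ltn_expl e p_gt1; lia.
- apply/negP => ps; have : (#[s ^+ (p ^ e)]%g %| m)%N.
    rewrite order_dvdn -expgM -order_dvdn; apply: (@dvdn_trans n).
      by exact: (@order_dvdG _ [set: G]%G s (finset.in_setT _)).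
    by rewrite nE mulnC dvdn_pmul2r // dvdn_exp2l //; lia.
  move/(dvdn_trans ps); apply/negP; by rewrite -prime_coprime.
- rewrite -[RHS]expg1; apply/eqP; rewrite eq_expg_mod_order.
  by rewrite -(modn_dvdm _ (order_dvd s ps)) pe1 modn_dvdm // order_dvd.
Qed.

(** * Twisted group rings *)

Section TwistedRing.
Variables (G : finGroupType) (C : pzRingType) (a : ring_action G C).
Local Notation A := (twisted a).

Lemma twistedM (s t : G) (y z : C) :
  (tw_elt a s y : A) * tw_elt a t z = tw_elt a (s * t)%g (a t y * z).
Proof. exact: tw_mul_elt. Qed.

Lemma twisted_sum (x : A) : x = \sum_s tw_elt a s (x s).
Proof.
apply/ffunP => t; rewrite sum_ffunE (bigD1 t) //= ffunE eqxx big1 ?addr0 // => s st.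
by rewrite ffunE eq_sym (negPf st).
Qed.

Lemma tw_eltB s : zmod_morphism (tw_elt a s : C -> A).
Proof. by move=> y z; apply/ffunP => t; rewrite !ffunE; case: eqP; rewrite ?subr0. Qed.

HB.instance Definition _ s := GRing.isZmodMorphism.Build C A (tw_elt a s) (@tw_eltB s).

Lemma twisted_exp (s : G) (y : C) n :
  (tw_elt a s y : A) ^+ n = tw_elt a (s ^+ n)%g (\prod_(i < n) a (s ^+ (n - i.+1))%g y).
Proof.
elim: n => [|n IHn]; first by rewrite big_ord0.
rewrite exprS IHn twistedM -expgS big_ord_recl subSS subn0; congr (tw_elt a _ (_ * _)).
Qed.

End TwistedRing.

Section TwistedCount.
Variables (G : finGroupType) (C : comPzRingType) (a : ring_action G C).
Variables (k : finFieldType) (iota : {rmorphism k -> C}).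
Hypothesis a_iota : forall s c, a s (iota c) = iota c.
Variables (p : nat) (X : {set G}).
Hypotheses (p_pr : prime p) (k_char : p%:R = 0 :> k) (X_reps : p'class_reps p X).
Variables (F : finType) (cov : F -> C).
Hypothesis cov_surj : forall y, exists c, y = cov c.

Local Notation A := (twisted a).
Local Notation T0 := (rquot (Jac C)).
Local Notation toT0 := (rpi (Jac C)).
Local Notation j := (tw_const a \o iota).

Variable a0 : ring_action G T0.
Hypothesis a0E : forall s y, a0 s (toT0 y) = toT0 (a s y).
(** [q t] stands for the projection of T_0 onto T_0 / V_t: it kills the generators of V_t, and by
    [q_ker] its kernel lies in every k-subspace that contains them. *)
Variables (U : G -> zmodType) (q : forall t, {additive T0 -> U t}).
Hypothesis q_surj : forall t u, exists y, q t y = u.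
Hypothesis q_ideal : forall t y z, q t ((a0 t y - y) * z) = 0.
Hypothesis q_centralizer :
  forall t r y, r \in 'C[t]%g -> q t (a0 r y - y) = 0.
Hypothesis q_ker : forall t (D : T0 -> Prop), D 0 ->
  (forall x y, D x -> D y -> D (x + y)) ->
  (forall c x, D x -> D (toT0 (iota c) * x)) ->
  (forall y z, D ((a0 t y - y) * z)) ->
  (forall r, r \in 'C[t]%g -> forall y, D (a0 r y - y)) ->
  forall y, q t y = 0 -> D y.

Let C_char : p%:R = 0 :> C.
Proof. by rewrite -(rmorph_nat iota) k_char rmorph0. Qed.

Let T0_char (y : T0) : y *+ p = 0.
Proof. by rewrite -[y]rreprK -rmorphMn -mulr_natr C_char mulr0 rmorph0. Qed.

Let U_char t (u : U t) : u *+ p = 0.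
Proof. by have [y <-] := q_surj u; rewrite -raddfMn T0_char raddf0. Qed.

Lemma toT0M y z : toT0 (y * z) = toT0 y * toT0 z.
Proof. exact: rpiM. Qed.

Lemma q_act t r y : r \in 'C[t]%g -> q t (a0 r y) = q t y.
Proof. by move=> rt; apply/eqP; rewrite -subr_eq0 -raddfB q_centralizer. Qed.

Lemma q_ideal_act t n y z : q t (a0 (t ^+ n)%g y * z) = q t (y * z).
Proof.
elim: n y => [|n IHn] y; first by rewrite expg0 ract1.
rewrite expgS ractM IHn; apply/eqP; rewrite -subr_eq0 -raddfB -mulrBl.
by rewrite q_ideal.
Qed.

(** By [q_ideal_act] translates of y by powers of t may be replaced by y inside any product. The
    extra factor z carries the induction. *)
Lemma q_norm t n y (e : nat -> nat) : q t (\prod_(i < n) a0 (t ^+ e i)%g y) = q t (y ^+ n).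
Proof.
suff E z : q t ((\prod_(i < n) a0 (t ^+ e i)%g y) * z) = q t (y ^+ n * z).
  by have := E 1; rewrite !mulr1.
elim: n z => [|n IHn] z; first by rewrite big_ord0.
by rewrite big_ord_recr /= -mulrA IHn mulrCA q_ideal_act exprS mulrA.
Qed.

(* 1 when s and t are not conjugate. *)
Definition conjugator (t s : G) : G := odflt 1%g [pick g | (s ^ g == t)%g].

Lemma conjugatorP t s : s \in (t ^: [set: G]%SET)%g -> (s ^ conjugator t s)%g = t.
Proof.
move=> /imsetP[g _ ->]; rewrite /conjugator; case: pickP => [h /eqP //|/(_ g^-1)%g].
by rewrite conjgK eqxx.
Qed.

(** The choice of conjugator is immaterial: two choices differ by an element of the centralizer of
    t, which [q t] ignores. This gives [class_proj_elt]. *)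
Definition class_proj t (x : A) : U t :=
  \sum_(s in (t ^: [set: G]%SET)%g) q t (a0 (conjugator t s) (toT0 (x s))).

Lemma class_projD t : {morph class_proj t : x y / x + y}.
Proof.
move=> x y; rewrite -big_split; apply: eq_bigr => s _.
by rewrite ffunE !raddfD.
Qed.

Lemma class_proj_sum t (I : Type) (r : seq I) (P : pred I) (E : I -> A) :
  class_proj t (\sum_(i <- r | P i) E i) = \sum_(i <- r | P i) class_proj t (E i).
Proof.
apply: (big_morph _ (@class_projD t)).
by apply: (addrI (class_proj t 0)); rewrite -class_projD !addr0.
Qed.

Lemma class_proj_elt t s y g : (s ^ g)%g = t ->
  class_proj t (tw_elt a s y) = q t (a0 g (toT0 y)).
Proof.
move=> sg; have st : s \in (t ^: [set: G]%SET)%g.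
  by rewrite -sg; apply/imsetP; exists g^-1%g; rewrite ?finset.in_setT ?conjgK.
rewrite /class_proj (bigD1 s) //= big1 ?addr0 => [|u /andP[_ us]].
  rewrite ffunE eqxx; set h := conjugator t s.
  rewrite -(mulKVg h g) ractM [RHS]q_act // cent1C; apply/cent1P/commgP/conjg_fixP.
  by rewrite -[in LHS](conjugatorP st) -conjgM mulKVg.
by rewrite ffunE (negPf us) !raddf0.
Qed.

Lemma class_proj_elt0 t s y : s \notin (t ^: [set: G]%SET)%g ->
  class_proj t (tw_elt a s y) = 0.
Proof.
move=> st; rewrite /class_proj big1 // => u ut; rewrite ffunE.
by case: eqP ut st => [->->//|_ _ _]; rewrite !raddf0.
Qed.

(** By bilinearity it is enough to compare (s y)(v z) with (v z)(s y). The group parts s v and v s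
    are conjugate by v, and after transport to t the coefficients differ only by the action of t on
    one factor. *)
Lemma class_proj_tracelike t : tracelike (class_proj t).
Proof.
split=> [|x y]; first exact: class_projD.
have bil (u w : A) : class_proj t (u * w) =
    \sum_s \sum_v class_proj t ((tw_elt a s (u s) : A) * tw_elt a v (w v)).
  rewrite [in LHS](twisted_sum u) [in LHS](twisted_sum w) mulr_suml class_proj_sum.
  by apply: eq_bigr => s _; rewrite mulr_sumr class_proj_sum.
rewrite !bil exchange_big; apply: eq_bigr => v _; apply: eq_bigr => s _.
rewrite !twistedM.
have conj_vs : ((v * s) ^ v = s * v)%g by rewrite conjgE -mulgA mulKg.
have [/imsetP[g _ svE]|svt] := boolP ((s * v)%g \in (t ^: [set: G]%SET)%g).
  have sv_t : ((s * v) ^ g^-1)%g = t by rewrite svE conjgK.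
  rewrite (class_proj_elt _ sv_t) (@class_proj_elt _ _ _ (v * g^-1)%g); last first.
    by rewrite conjgM conj_vs.
  rewrite !toT0M -!a0E.
  set Y := toT0 (y v); set Z := toT0 (x s).
  rewrite !rmorphM -!ractM.
  have -> : (s * (v * g^-1) = g^-1 * t ^+ 1)%g.
    by rewrite expg1 -sv_t conjgE invgK !mulgA mulVg mul1g.
  by rewrite [a0 (g^-1 * _)%g _]ractM q_ideal_act mulrC.
rewrite !class_proj_elt0 //; apply: contra svt => /imsetP[g _ vsE].
by rewrite -conj_vs vsE -conjgM; apply/imsetP; exists (g * v)%g; rewrite ?finset.in_setT.
Qed.

(** * Traces in an irreducible representation of the twisted group ring *)

Section Representation.
Variables (n : nat) (rho : {rmorphism A -> 'M[k]_n.+1}).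
Hypothesis rho_irr : irreducible_rep rho.
Hypothesis rho_scalar : forall c, rho (j c) = c%:M.

(** Jac C consists of finitely many commuting nilpotent elements. A common null vector is built one
    element y at a time, by applying to v the last power of y that does not kill it. *)
Lemma Jac_common_kernel : exists2 v : 'cV[k]_n.+1, v != 0 &
  forall y, Jac C y -> rho (tw_const a y) *m v = 0.
Proof.
suff common (l : seq C) : (forall y, y \in l -> Jac C y) ->
    exists2 v : 'cV[k]_n.+1, v != 0 & forall y, y \in l -> rho (tw_const a y) *m v = 0.
  have [|v v0 vP] := common [seq y <- [seq cov c | c <- enum F] | `[< Jac C y >]].
    by move=> y; rewrite mem_filter => /andP[/asboolP].
  exists v => // y Jy; apply: vP; rewrite mem_filter; apply/andP; split; first exact/asboolP.
  by have [c ->] := cov_surj y; apply: map_f; rewrite mem_enum.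
elim: l => [|y l IHl] Jl.
  by exists (const_mx 1) => //; apply/cV0Pn; exists 0; rewrite mxE oner_neq0.
have [z zl|v v0 vl] := IHl; first by apply: Jl; rewrite inE zl orbT.
have [e ye] := Jac_nilpotent cov_surj (Jl y (mem_head _ _)).
have ex0 : exists e, rho (tw_const a y ^+ e) *m v == 0.
  by exists e; rewrite -rmorphXn ye !rmorph0 mul0mx.
case: (ex_minnP ex0) => -[|d] d0 d_min.
  by rewrite expr0 rmorph1 mul1mx (negPf v0) in d0.
exists (rho (tw_const a y ^+ d) *m v).
  by apply/negP => /d_min; rewrite ltnn.
move=> z; rewrite inE => /predU1P[->|zl].
  by rewrite mulmxA -[_ *m rho _]/(_ * _) -rmorphM -exprS (eqP d0).
rewrite mulmxA -[_ *m rho _]/(_ * _) -rmorphM -rmorphXn -rmorphM mulrC.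
by rewrite !rmorphM -[_ * _]/(_ *m _) -mulmxA vl // mulmx0.
Qed.

(** Every vector is x v with v from [Jac_common_kernel], and elements of Jac C move past group
    elements because Jac C is stable under G. *)
Lemma rho_Jac s y : Jac C y -> rho (tw_elt a s y) = 0.
Proof.
move=> Jy; have [v v0 vP] := Jac_common_kernel.
have const0 z : Jac C z -> rho (tw_const a z) = 0.
  move=> Jz; apply: mulmx_col_inj => w; rewrite mul0mx.
  have [x <-] := rho_irr w v0.
  rewrite mulmxA -[_ *m rho _]/(_ * _) -rmorphM (twisted_sum x) mulr_sumr.
  rewrite rmorph_sum mulmx_suml big1 // => t _.
  have -> : tw_const a z * tw_elt a t (x t) =
      (tw_elt a t (x t) : A) * tw_const a (a t z).
    by rewrite !twistedM mul1g mulg1 ract1 mulrC.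
  by rewrite rmorphM -[_ * _]/(_ *m _) -mulmxA vP ?mulmx0 //; apply: Jac_stable.
have -> : tw_elt a s y = (tw_elt a s 1 : A) * tw_const a y.
  by rewrite twistedM mulg1 ract1 mul1r.
by rewrite rmorphM const0 // mulr0.
Qed.

Let tr (x : A) := \tr (rho x).

Let tr_tracelike : tracelike tr.
Proof.
split=> [x y|x y]; first by rewrite /tr rmorphD mxtraceD.
by rewrite /tr (rmorphM rho x) (rmorphM rho y); apply: mxtrace_mulC.
Qed.

Lemma tr_conj s g y : tr (tw_elt a s y) = tr (tw_elt a (s ^ g)%g (a g y)).
Proof.
have -> : tw_elt a (s ^ g)%g (a g y) =
    (tw_elt a g^-1%g 1 : A) * (tw_elt a s y * tw_elt a g 1).
  by rewrite !twistedM rmorph1 mul1r mulr1.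
rewrite (tracelikeC tr_tracelike) -mulrA !twistedM mulgV mulg1.
by rewrite ract1 mulr1 rmorph1 mulr1.
Qed.

(** [D] collects the z with tr(t z) = 0, which makes sense modulo Jac C by [rho_Jac]. It is a
    k-subspace that contains the generators of V_t. *)
Lemma tr_kernel t y : q t (toT0 y) = 0 -> tr (tw_elt a t y) = 0.
Proof.
pose D (z : T0) := tr (tw_elt a t (rrepr z)) = 0.
have trD u w : tr (tw_elt a t (u + w)) = tr (tw_elt a t u) + tr (tw_elt a t w).
  by rewrite raddfD (tracelikeD tr_tracelike).
have trB u w : tr (tw_elt a t (u - w)) = tr (tw_elt a t u) - tr (tw_elt a t w).
  by rewrite raddfB (tracelikeB tr_tracelike).
have reprE z : tr (tw_elt a t (rrepr (toT0 z))) = tr (tw_elt a t z).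
  by apply/eqP; rewrite -subr_eq0 -trB /tr rho_Jac ?raddf0 //; exact: rreprP.
have DE z : D (toT0 z) <-> tr (tw_elt a t z) = 0 by rewrite /D reprE.
move=> /(@q_ker t D) Dy; apply/DE/Dy => {Dy}.
- by rewrite -(rmorph0 toT0); apply/DE; rewrite raddf0 (tracelike0 tr_tracelike).
- move=> u w; rewrite -[u]rreprK -[w]rreprK -rmorphD => /DE du /DE dw; apply/DE.
  by rewrite trD du dw addr0.
- move=> c u; rewrite -[u]rreprK -toT0M => /DE du; apply/DE.
  have -> : tw_elt a t (iota c * rrepr u) = j c * (tw_elt a t (rrepr u) : A).
    by rewrite /= twistedM mul1g a_iota.
  rewrite /tr rmorphM rho_scalar -[_ * _]/(_ *m _) mul_scalar_mx mxtraceZ.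
  by rewrite [\tr _]du mulr0.
(* The products u (t w) = t (u^t w) and (t w) u = t (w u) have the same trace. *)
- move=> u w; rewrite -[u]rreprK -[w]rreprK a0E -rmorphB -toT0M; apply/DE.
  rewrite mulrBl trB; apply/eqP; rewrite subr_eq0; apply/eqP.
  have -> : tw_elt a t (a t (rrepr u) * rrepr w) =
      tw_const a (rrepr u) * (tw_elt a t (rrepr w) : A).
    by rewrite twistedM mul1g.
  by rewrite (tracelikeC tr_tracelike) twistedM mulg1 ract1 mulrC.
move=> r rt u; rewrite -[u]rreprK a0E -rmorphB; apply/DE.
rewrite trB [tr (tw_elt a t (rrepr u))](tr_conj _ r).
suff -> : (t ^ r)%g = t by rewrite subrr.
by apply/conjg_fixP/commgP/cent1P; rewrite cent1C.
Qed.

(** Conjugation moves each class onto its representative t without changing traces, and the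
    collected coefficient at t is killed by [q t]. *)
Lemma tr_class_proj (w : A) : (forall t, t \in X -> class_proj t w = 0) ->
  (forall s, (p %| #[s]%g)%N -> w s = 0) -> tr w = 0.
Proof.
move=> w_proj w_supp; rewrite (twisted_sum w) (tracelike_sum tr_tracelike).
pose E s := tr (tw_elt a s (w s)).
have -> : \sum_s tr (tw_elt a s (w s)) =
    \sum_(t in X) \sum_(s in (t ^: [set: G]%SET)%g) E s.
  rewrite [RHS](exchange_big_dep xpredT) //=; apply: eq_bigr => s _.
  have [ps|/X_reps.2[t [[tX ts] t_uniq]]] := boolP (p %| #[s]%g)%N.
    have E0 : E s = 0 by rewrite /E w_supp // raddf0 (tracelike0 tr_tracelike).
    by rewrite -/(E s) E0 [RHS]big1.
  rewrite [RHS](big_pred1 t) // => u; apply/andP/eqP => [[uX su]|->].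
    by apply/esym/t_uniq; split=> //; rewrite class_sym.
  by rewrite class_sym.
rewrite big1 // => t tX.
have -> : \sum_(s in (t ^: [set: G]%SET)%g) E s =
    tr (tw_elt a t (\sum_(s in (t ^: [set: G]%SET)%g) a (conjugator t s) (w s))).
  rewrite raddf_sum (tracelike_sum tr_tracelike); apply: eq_bigr => s st.
  by rewrite /E (tr_conj _ (conjugator t s)) conjugatorP.
apply: tr_kernel; rewrite !rmorph_sum raddf_sum -[RHS](w_proj _ tX).
by apply: eq_bigr => s _; rewrite a0E.
Qed.

End Representation.

Lemma class_map_exists : exists Phi : forall t, A -> U t,
  [/\ forall t, tracelike (Phi t),
      forall u : forall t, U t, exists x, forall t, t \in X -> Phi t x = u t,
      forall t x n, x ^+ n = 0 -> Phi t x = 0 &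
      forall n (rho : {rmorphism A -> 'M[k]_n.+1}), irreducible_rep rho ->
        (forall c, rho (j c) = c%:M) ->
        forall x, (forall t, t \in X -> Phi t x = 0) -> \tr (rho x) = 0].
Proof.
(* [#|{ffun G -> F}|] bounds the cardinality of A, hence the index of its nilpotent elements. *)
have [e [e_big p'_e fix_e]] := p'_exponent G #|{ffun G -> F}| p_pr.
set Q := (p ^ e)%N in e_big p'_e fix_e.
pose Phi t (x : A) := class_proj t (x ^+ Q).
have Phi_tr t : tracelike (Phi t).
  have := tracelike_iter_Frobenius p_pr (@U_char t) e (class_proj_tracelike t).
  by rewrite -/Q.
exists Phi; split=> // [u|t x n xn|n rho irr_rho rho_j x x0].
- have y_ex t : exists y : C, q t (toT0 y ^+ Q) = u t.
    have [z <-] := q_surj (u t).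
    have [y ->] := Jac_quotient_perfect cov_surj e z p_pr C_char.
    by exists (rrepr y); rewrite rreprK.
  have [y yE] := choice y_ex.
  exists (\sum_(t in X) tw_elt a t (y t)) => t tX.
  (* Distinct representatives are not conjugate, so only the summand at t contributes. *)
  rewrite (tracelike_sum (Phi_tr t)) (bigD1 t) //= big1 => [|v /andP[vX vt]]; last first.
    rewrite /Phi twisted_exp (fix_e v) ?(X_reps.1 v vX) // class_proj_elt0 //.
    apply: contra vt => vt; apply/eqP.
    have [w [_ w_uniq]] := X_reps.2 _ (X_reps.1 t tX).
    rewrite -(w_uniq v) //; apply/esym/esym; apply: w_uniq; split=> //.
    by rewrite class_refl.
  rewrite addr0 /Phi twisted_exp (fix_e t) ?(X_reps.1 t tX) //.
  rewrite (class_proj_elt _ (g := 1%g)) ?conjg1 // ract1.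
  have -> : toT0 (\prod_(i < Q) a (t ^+ (Q - i.+1))%g (y t)) =
      \prod_(i < Q) a0 (t ^+ (Q - i.+1))%g (toT0 (y t)).
    by rewrite rmorph_prod; apply: eq_bigr => i _; rewrite a0E.
  by rewrite (@q_norm t Q _ (fun i => Q - i.+1)%N) yE.
- have cover (z : A) : exists c : {ffun G -> F}, z = [ffun s => cov (c s)].
    have [c cE] := choice (fun s => cov_surj (z s)).
    by exists [ffun s => c s]; apply/ffunP => s; rewrite !ffunE.
  (* The powers of x are periodic from x^i on, so x^n = 0 forces x^i = 0, and i is at most Q. *)
  have [i [l [/andP[il lF] xil]]] := cover_repeat cover (GRing.exp x).
  have x_per m : x ^+ i = x ^+ (i + m * (l - i)).
    elim: m => [|m IHm]; first by rewrite mul0n addn0.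
    by rewrite mulSn addnCA exprD -IHm -exprD addnC subnKC ?(ltnW il).
  have xi : x ^+ i = 0.
    rewrite (x_per n) -(subnK (_ : n <= i + n * (l - i))%N) ?exprD ?xn ?mulr0 //.
    by rewrite (leq_trans _ (leq_addl _ _)) // leq_pmulr // subn_gt0.
  have iQ : (i <= Q)%N := leq_trans (leq_trans (ltnW il) lF) e_big.
  rewrite /Phi -(subnK iQ) exprD xi mulr0.
  exact: (tracelike0 (class_proj_tracelike t)).
have tr_tr : tracelike (fun z => \tr (rho z)).
  split=> [z w|z w]; first by rewrite rmorphD mxtraceD.
  by rewrite (rmorphM rho z) (rmorphM rho w); apply: mxtrace_mulC.
have kU (c : k) : c *+ p = 0 by rewrite -mulr_natr k_char mulr0.
have trQ_tr := tracelike_iter_Frobenius p_pr kU e tr_tr.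
(* Since x |-> tr(x^Q) is additive, tr(x)^Q is the trace of [w], which is supported on p'-elements
   and has the class projections [Phi t x]. *)
pose w : A := \sum_s (tw_elt a s (x s) : A) ^+ Q.
have trw : \tr (rho x) ^+ Q = \tr (rho w).
  rewrite -mxtrace_Frobenius // -rmorphXn {1}(twisted_sum x).
  by rewrite (tracelike_sum trQ_tr) /w (tracelike_sum tr_tr).
suff trw0 : \tr (rho w) = 0.
  by move/eqP: trw; rewrite trw0 expf_eq0 => /andP[_ /eqP].
apply: (tr_class_proj irr_rho rho_j) => [t tX|s ps].
  rewrite -(x0 t tX) (twisted_sum x) (tracelike_sum (Phi_tr t)).
  exact: class_proj_sum.
rewrite /w sum_ffunE big1 // => u _; rewrite twisted_exp ffunE.
by case: eqP ps => // -> ps; have := p'_e u; rewrite ps.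
Qed.

End TwistedCount.

Theorem num_simple_twisted (G : finGroupType) (C : comPzRingType)
    (a : ring_action G C) (k : finFieldType) (iota : {rmorphism k -> C})
    (j : {rmorphism k -> twisted a}) (p : nat) (X : {set G})
    (a0 : ring_action G (rquot (Jac C))) (m : nat) (g : 'I_m -> C) (d : G -> nat)
    (q : forall t, {additive rquot (Jac C) -> {ffun 'I_(d t) -> k}}) :
    (forall s c, a s (iota c) = iota c) -> (forall c, j c = tw_const a (iota c)) ->
    prime p -> p%:R = 0 :> k -> p'class_reps p X ->
    (forall y, exists c : {ffun 'I_m -> k}, y = \sum_i iota (c i) * g i) ->
    (forall s y, a0 s (rpi (Jac C) y) = rpi (Jac C) (a s y)) ->
    (forall t u, exists y, q t y = u) ->
    (forall t y z, q t ((a0 t y - y) * z) = 0) ->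
    (forall t r y, r \in 'C[t]%g -> q t (a0 r y - y) = 0) ->
    (forall t (D : rquot (Jac C) -> Prop), D 0 ->
      (forall x y, D x -> D y -> D (x + y)) ->
      (forall c x, D x -> D (rpi (Jac C) (iota c) * x)) ->
      (forall y z, D ((a0 t y - y) * z)) ->
      (forall r, r \in 'C[t]%g -> forall y, D (a0 r y - y)) ->
      forall y, q t y = 0 -> D y) ->
    (forall V : lmodType (twisted a), simple_module V -> absolutely_simple j V) ->
  num_simple_modules (twisted a) (\sum_(t in X) d t)%N.
Proof.
move=> a_iota jE p_pr k_char X_reps g_span a0E q_surj q_ideal q_cent q_ker splitA.
have [Phi [Phi_tr Phi_surj Phi_nil Phi_ker]] :=
  class_map_exists a_iota p_pr k_char X_reps g_span a0E q_surj q_ideal q_cent q_ker.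
(* The disjoint union of the coordinate sets of the T_0 / V_t for t in X. *)
pose I := {t : {t | t \in X} & 'I_(d (val t))}.
have <- : #|{: I}| = (\sum_(t in X) d t)%N.
  rewrite card_tagged sumnE big_map big_enum /=.
  under eq_bigr do rewrite card_ord.
  by rewrite [RHS]big_sub.
pose Psi x : {ffun I -> k} := [ffun u => Phi (val (tag u)) x (tagged u)].
pose idx t (tX : t \in X) (i : 'I_(d t)) : I :=
  Tagged (fun t => 'I_(d (val t))) (i : 'I_(d (val (exist (fun t => t \in X) t tX)))).
have PsiE x t tX i : Psi x (idx t tX i) = Phi t x i by rewrite ffunE.
pose h (i : 'I_#|{: G * 'I_m}|) : twisted a := let u := enum_val i in tw_elt a u.1 (g u.2).
apply: (@num_simple_modules_tracelike k _ j _ _ h _ splitA _ Psi).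
- move=> c x; rewrite jE (twisted_sum x) mulr_sumr mulr_suml; apply: eq_bigr => s _.
  by rewrite !twistedM mul1g mulg1 a_iota ract1 mulrC.
- move=> x; have [c cE] := choice (fun s => g_span (x s)).
  exists (fun i => c (enum_val i).1 (enum_val i).2).
  transitivity (\sum_(u : G * 'I_m) j (c u.1 u.2) * (tw_elt a u.1 (g u.2) : twisted a)).
    rewrite [LHS]twisted_sum.
    rewrite -(pair_bigA _ (fun s l => j (c s l) * (tw_elt a s (g l) : twisted a))).
    apply: eq_bigr => s _; rewrite [in LHS]cE raddf_sum; apply: eq_bigr => l _.
    by rewrite jE twistedM mul1g a_iota.
  by rewrite (big_enum_val (A := {: G * 'I_m})).
- split=> [x y|x y]; apply/ffunP => u; rewrite !ffunE.
    by rewrite (tracelikeD (Phi_tr _)) ffunE.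
  by rewrite (tracelikeC (Phi_tr _)).
- move=> u.
  (* Only t in X matters; elsewhere the target value is 0. *)
  pose v t : {ffun 'I_(d t) -> k} :=
    if boolP (t \in X) is AltTrue tX then [ffun i => u (idx t tX i)] else 0.
  have [x xE] := Phi_surj v; exists x; apply/ffunP => -[[t tX] i].
  rewrite -[LHS]/(Psi x (idx t tX i)) PsiE xE // /v.
  case: {-}_ / boolP => [tX'|]; last by rewrite tX.
  by rewrite ffunE (bool_irrelevance tX' tX).
- move=> x n xn; apply/ffunP => u; rewrite !ffunE.
  by rewrite (Phi_nil _ _ _ xn) ffunE.
move=> n rho irr_rho rho_j x x0; apply: (Phi_ker n rho irr_rho) => [c|t tX].
  by rewrite -rho_j jE.
by apply/ffunP => i; rewrite -(PsiE x t tX) x0 !ffunE.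
Qed.

(** * Reduction modulo the uniformizer *)

Section FiniteField.
Variable R : comPzRingType.

Definition field_like : Prop :=
  (1 : R) != 0 /\ forall x : R, x != 0 -> exists y, y * x = 1.

Hypotheses (R_field : field_like) (R_fin : finite_set [set: R]).

(** The proofs are arguments so that field and finite structures can be attached; the ring itself is
    unchanged, and so are the maps out of it. *)
Definition finite_field_of of field_like & finite_set [set: R] : Type := R.
Local Notation k := (finite_field_of R_field R_fin).

HB.instance Definition _ := GRing.ComPzRing.on k.
HB.instance Definition _ := GRing.PzSemiRing_isNonZero.Build k R_field.1.

Lemma field_like_inv : exists f : k -> k, (forall x, x != 0 -> f x * x = 1) /\ f 0 = 0.
Proof.
have inv_ex (x : k) : exists y, (x != 0 -> y * x = 1) /\ (x = 0 -> y = 0).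
  have [->|x0] := eqVneq x 0; first by exists 0; split.
  by have [y yx] := R_field.2 x x0; exists y; split=> // /eqP; rewrite (negPf x0).
have [f fP] := choice inv_ex.
by exists f; split=> [x|]; [exact: (fP x).1 | exact: (fP 0).2].
Qed.

Let f := sval (cid field_like_inv).
Let fV x : x != 0 -> f x * x = 1. Proof. exact: (svalP (cid field_like_inv)).1. Qed.
Let f0 : f 0 = 0. Proof. exact: (svalP (cid field_like_inv)).2. Qed.

HB.instance Definition _ := GRing.ComNzRing_isField.Build k fV f0.

Lemma field_like_enum : exists s : seq k, forall x, x \in s.
Proof.
have /finite_seqP[s sE] := R_fin; exists s => x.
by have : [set: R] x by []; rewrite sE.
Qed.

Let s := sval (cid field_like_enum).
Let sP x : x \in s := svalP (cid field_like_enum) x.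
Let rank (x : k) : nat := index x s.
Let unrank n : option k := if (n < size s)%N then Some (nth 0 s n) else None.
Let rankK : pcancel rank unrank.
Proof. by move=> x; rewrite /unrank /rank index_mem sP nth_index. Qed.

HB.instance Definition _ := isCountable.Build k rankK.

Let enumP : Finite.axiom (undup s).
Proof. by move=> x; rewrite count_uniq_mem ?undup_uniq // mem_undup sP. Qed.

HB.instance Definition _ := isFinite.Build k enumP.

End FiniteField.

(** In the induction step, n + 1 vectors without a relation span, because adding any v yields a
    relation in which v has a nonzero coefficient. *)
Lemma dependent_spans (k : fieldType) (M : lmodType k) n :
    (forall y : 'I_n.+1 -> M, exists c : 'I_n.+1 -> k,
      (exists i, c i != 0) /\ \sum_i c i *: y i = 0) ->
  exists m (g : 'I_m -> M), spans g.
Proof.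
elim: n => [|n IHn] dep.
  exists 0%N, (fun=> 0) => v; exists [ffun=> 0]; rewrite big_ord0.
  have [c [[i]]] := dep (fun=> v); rewrite big_ord1 [i]ord1 => c0 /eqP.
  by rewrite scaler_eq0 (negPf c0) => /eqP.
have [/IHn //|] := pselect (forall y : 'I_n.+1 -> M, exists c : 'I_n.+1 -> k,
  (exists i, c i != 0) /\ \sum_i c i *: y i = 0).
move=> /existsNP[g /forallNP g_free]; exists n.+1, g => v.
have [c [[i0 ci0]]] := dep (fun i => if unlift ord0 i is Some l then g l else v).
rewrite big_ord_recl unlift_none; under eq_bigr do rewrite liftK.
move=> c_rel; have c0 : c ord0 != 0.
  apply/eqP => c0; apply: (g_free (fun l => c (lift ord0 l))); split; last first.
    by move: c_rel; rewrite c0 scale0r add0r.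
  by case: (unliftP ord0 i0) ci0 => [l ->|->]; [exists l | rewrite c0 eqxx].
exists [ffun l => - (c ord0)^-1 * c (lift ord0 l)].
move/eqP: c_rel; rewrite addr_eq0 => /eqP c_rel.
rewrite -[v]scale1r -(mulVf c0) -scalerA c_rel scalerN -scaleNr scaler_sumr.
by apply: eq_bigr => l _; rewrite ffunE scalerA.
Qed.

Lemma fixed_field_dependent (G : finGroupType) (L : fieldType) (a : ring_action G L)
    (y : 'I_#|G|.+1 -> L) :
  exists c : 'I_#|G|.+1 -> fixed_field a,
    (exists i, c i != 0) /\ \sum_i val (c i) * y i = 0.
Proof.
set n := #|G| in y *.
pose sol (c : 'rV[L]_n.+1) := forall s, \sum_i c 0 i * a s (y i) = 0.
pose supp (c : 'rV[L]_n.+1) := [set i | c 0 i != 0]%SET.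
pose P m := `[< exists c, [/\ c != 0, sol c & #|supp c| = m] >].
have exP : exists m, P m.
  (* One equation for each s in G, in [#|G|] + 1 unknowns. *)
  pose M : 'M[L]_(n.+1, n) := \matrix_(i, l) a (enum_val l) (y i).
  have : kermx M != 0.
    by rewrite kermx_eq0 /row_free neq_ltn ltnS rank_leq_col.
  move=> /rowV0Pn[c /sub_kermxP cM c0].
  exists #|supp c|; apply/asboolP; exists c; split=> // s.
  have := congr1 (fun B : 'rV_n => B 0 (enum_rank s)) cM; rewrite !mxE => E.
  rewrite -[RHS]E.
  by apply: eq_bigr => i _; rewrite mxE enum_rankK.
(* A solution of minimal support with an entry equal to 1 is fixed by G, because
   its difference with a conjugate has smaller support. *)
case: (ex_minnP exP) => m /asboolP[c [c0 c_sol cm]] m_min.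
have [i0 ci0] : exists i, c 0 i != 0 by apply/rV0Pn.
pose d := (c 0 i0)^-1 *: c.
have d_sol : sol d.
  move=> s; under eq_bigr do rewrite mxE -mulrA.
  by rewrite -mulr_sumr c_sol mulr0.
have di0 : d 0 i0 = 1 by rewrite mxE mulVf.
have d_fix i : d 0 i \in fixed_pred a.
  apply/fixed_predP => t.
  pose e : 'rV[L]_n.+1 := \row_i (a t (d 0 i) - d 0 i).
  (* Applying t permutes the equations, so conjugates of solutions are solutions. *)
  have e_sol : sol e.
    move=> s; under eq_bigr do rewrite mxE mulrBl.
    rewrite sumrB d_sol subr0 -[RHS](rmorph0 (a t)) -[in RHS](d_sol (s * t^-1)%g).
    by rewrite rmorph_sum; apply: eq_bigr => l _; rewrite rmorphM -ractM mulgKV.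
  have [e0|e0] := eqVneq e 0.
    apply/eqP; rewrite -subr_eq0.
    by have := congr1 (fun B : 'rV_n.+1 => B 0 i) e0; rewrite !mxE => ->.
  have : (m <= #|supp e|)%N by apply: m_min; apply/asboolP; exists e.
  have sub_ec : supp e \subset supp c :\ i0.
    apply/fintype.subsetP => l; rewrite !inE mxE => el; apply/andP; split.
      by apply: contraNneq el => ->; rewrite di0 rmorph1 subrr.
    by apply: contraNneq el => cl; rewrite mxE cl mulr0 rmorph0 subrr.
  move/leq_trans/(_ (subset_leq_card sub_ec)).
  by rewrite -cm (cardsD1 i0 (supp c)) inE ci0 add1n ltnn.
exists (fun i => SubfieldElt (d_fix i)); split.
  by exists i0; apply/negP => /eqP/(congr1 val) /= /eqP; rewrite di0 oner_eq0.
by rewrite -[RHS](d_sol 1%g); apply: eq_bigr => i _; rewrite ract1.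
Qed.

Section Reduction.
Variables (G : finGroupType) (L : fieldType) (a : ring_action G L).
Variables (S : subringClosed (fixed_field a)) (pi : subring_type S).
Hypotheses (S_dvr : is_dvr pi) (S_frac : fraction_field_cond S).

Lemma fraction_common_denominator n (c : 'I_n -> fixed_field a) :
  exists (D : subring_type S) (b : 'I_n -> subring_type S),
    D != 0 /\ forall i, val (b i) = val D * c i.
Proof.
have frac i : exists e : subring_type S * subring_type S,
    val e.2 != 0 /\ c i = val e.1 / val e.2.
  by have [b [d [d0 cE]]] := S_frac (c i); exists (b, d).
have [e eP] := choice frac.
exists (\prod_i (e i).2), (fun i => (e i).1 * \prod_(l | l != i) (e l).2).
have prod_val (P : pred 'I_n) :
    val (\prod_(i | P i) (e i).2) = \prod_(i | P i) val (e i).2.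
  exact: (rmorph_prod (val : {rmorphism subring_type S -> fixed_field a})).
split=> [|i].
  rewrite -(inj_eq val_inj) prod_val; apply/prodf_neq0 => i _.
  exact: (eP i).1.
transitivity (val (e i).1 * \prod_(l | l != i) val (e l).2); first by rewrite -prod_val.
have [e0 ->] := eP i; rewrite prod_val [in RHS](bigD1 i) //.
by rewrite [RHS]mulrAC; congr (_ * _); rewrite mulrCA divff ?mulr1.
Qed.

(** Divide by a generator d of the ideal generated by the coefficients: the quotients generate the
    unit ideal, so not all of them are multiples of pi. *)
Lemma dvr_primitive n (b : 'I_n -> subring_type S) (y : 'I_n -> L) :
    (exists i, b i != 0) -> \sum_i S_to_L S (b i) * y i = 0 ->
  exists b' : 'I_n -> subring_type S,
    (exists i, ~ principal pi (b' i)) /\ \sum_i S_to_L S (b' i) * y i = 0.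
Proof.
move=> [i0 bi0] b_rel; have [_ pid _ [pi1 _] _] := S_dvr.
pose I_set (x : subring_type S) := exists e : 'I_n -> subring_type S, x = \sum_i e i * b i.
have I0 : I_set 0 by exists (fun=> 0); rewrite big1 // => i _; rewrite mul0r.
have ID u v : I_set u -> I_set v -> I_set (u + v).
  move=> [e ->] [f ->]; exists (fun i => e i + f i).
  by rewrite -big_split; apply: eq_bigr => i _; rewrite mulrDl.
have IM w u : I_set u -> I_set (w * u).
  move=> [e ->]; exists (fun i => w * e i).
  by rewrite mulr_sumr; apply: eq_bigr => i _; rewrite mulrA.
have [d dE] := pid (Ideal I0 ID IM).
have b_div i : exists q, b i = q * d.
  apply/(dE (b i)) => /=; exists (fun l => (l == i)%:R).
  by rewrite (bigD1 i) //= eqxx mul1r big1 ?addr0 // => l /negPf ->; rewrite mul0r.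
have [q qE] := choice b_div.
have [e eE] : I_set d by apply/(dE d); exists 1; rewrite mul1r.
have d0 : d != 0 by apply: contraNneq bi0 => d0; rewrite qE d0 mulr0.
have dL0 : S_to_L S d != 0.
  by apply: contraNneq d0 => dL; apply/eqP/val_inj/val_inj.
have dom : GRing.integral_domain_axiom (subring_type S) by have [] := S_dvr.
exists q; split.
  apply: contrapT => /forallNP all_pi; apply: pi1.
  have : (\sum_i e i * q i - 1) * d = 0.
    rewrite mulrBl mul1r {2}eE mulr_suml; apply/eqP; rewrite subr_eq0; apply/eqP.
    by apply: eq_bigr => i _; rewrite qE mulrA.
  move/dom; rewrite (negPf d0) orbF subr_eq0 => /eqP <-.
  elim/big_ind: _ => [|u v|i _]; [exact: ideal0|exact: idealD|apply: idealM].
  by apply: contrapT; apply: all_pi.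
apply: (mulfI dL0); rewrite mulr0 -[RHS]b_rel mulr_sumr; apply: eq_bigr => i _.
by rewrite [in RHS]qE rmorphM mulrA [S_to_L S d * _]mulrC.
Qed.

(** Lift to T, take a relation over K, clear denominators, make it primitive and reduce modulo pi;
    primitivity keeps the reduction nontrivial. *)
Lemma Tbar_dependent (y : 'I_#|G|.+1 -> Tbar pi) :
  exists c : 'I_#|G|.+1 -> Sbar pi,
    (exists i, c i != 0) /\ \sum_i Sbar_to_Tbar pi (c i) * y i = 0.
Proof.
have [c [[i0 ci0] c_rel]] := fixed_field_dependent a (fun i => val (rrepr (y i))).
have [D [b [D0 bE]]] := fraction_common_denominator c.
have [|| b' [[i bi] b'_rel]] := @dvr_primitive _ b (fun i => val (rrepr (y i))).
- by exists i0; rewrite -(inj_eq val_inj) bE mulf_neq0.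
- rewrite -[RHS](mulr0 (val (val D))) -[in RHS]c_rel.
  rewrite mulr_sumr; apply: eq_bigr => l _; rewrite mulrA; congr (_ * _).
  by rewrite /S_to_L /= bE.
exists (fun i => rpi _ (b' i)); split.
  exists i; apply/negP => /eqP; rewrite -(rmorph0 (rpi _)) => /rpi_eq.
  by rewrite subr0.
have rel_T : \sum_i S_to_T S (b' i) * rrepr (y i) = 0.
  apply: val_inj; rewrite -[RHS]b'_rel.
  by rewrite (rmorph_sum (val : {rmorphism T_ring S -> L})).
rewrite -[RHS](rmorph0 (rpi (piT pi))) -[in RHS]rel_T rmorph_sum; apply: eq_bigr => l _.
by rewrite [RHS]rmorphM qmapE -[y l in LHS]rreprK.
Qed.

Lemma Sbar_field_like : field_like (Sbar pi).
Proof.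
have [_ _ _ [pi1 pi_max] _] := S_dvr; split.
  by apply/eqP; rewrite -(rmorph1 (rpi _)) -(rmorph0 (rpi _)) => /rpi_eq; rewrite subr0.
move=> x; rewrite -[x]rreprK; set s := rrepr x => s0.
pose J (u : subring_type S) := exists b c, u = b * pi + c * s.
have J0 : J 0 by exists 0, 0; rewrite !mul0r addr0.
have JD u v : J u -> J v -> J (u + v).
  move=> [b [c ->]] [b' [c' ->]]; exists (b + b'), (c + c').
  by rewrite !mulrDl addrACA.
have JM w u : J u -> J (w * u).
  by move=> [b [c ->]]; exists (w * b), (w * c); rewrite mulrDr !mulrA.
have [b [c E]] : J 1.
  apply: contrapT => J1; move/eqP: s0; apply; rewrite -(rmorph0 (rpi _)).
  apply/rpi_eq; rewrite subr0; apply: (pi_max (Ideal J0 JD JM)) => //=.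
    by move=> _ [b ->]; exists b, 0; rewrite mul0r addr0.
  by exists 0, 1; rewrite mul0r add0r mul1r.
exists (rpi _ c); rewrite -rmorphM -(rmorph1 (rpi _)); apply/rpi_eq.
by rewrite E opprD addrCA subrr addr0 -mulNr; exists (- b).
Qed.

Lemma Tbar_act_const s c : Tbar_action pi s (Sbar_to_Tbar pi c) = Sbar_to_Tbar pi c.
Proof.
have E : Sbar_to_Tbar pi c = rpi (piT pi) (S_to_T S (rrepr c)) by [].
by rewrite E [LHS]qmapE; congr (rpi _ _); apply: val_inj; exact: act_S_to_L.
Qed.

End Reduction.

(** * Coordinates on T_0 / V_sigma and the final count *)

Lemma mdim_basis (k : fieldType) (M : lmodType k) n (g : 'I_n -> M) :
  spans g -> exists e : 'I_(mdim M) -> M, is_basis e.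
Proof.
move=> /spans_basis[d e_basis].
(* A finite basis exists, so [xget] does not fall back on its default. *)
by rewrite /mdim; case: xgetP => [m _ //|/(_ d)].
Qed.

Lemma basis_coordinates (k : fieldType) (M : lmodType k) n (e : 'I_n -> M) :
  is_basis e -> exists co : {additive M -> {ffun 'I_n -> k}}, bijective co.
Proof.
move=> e_basis; have [co coP] := choice e_basis.
pose s (c : {ffun 'I_n -> k}) := \sum_i c i *: e i.
have coK : cancel co s by move=> v; rewrite [RHS](coP v).1.
have sK : cancel s co by move=> c; apply: (coP _).2.
have coB : zmod_morphism co.
  move=> u v; apply: (can_inj sK); rewrite coK /s.
  under eq_bigr do rewrite !ffunE scalerDl scaleNr.
  by rewrite big_split sumrN /= -!(coP _).1.
exists (HB.pack_for {additive M -> {ffun 'I_n -> k}} co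
  (GRing.isZmodMorphism.Build _ _ co coB)).
by exists s.
Qed.

Theorem corollary3p16 (G : finGroupType) (L : fieldType)
    (a : ring_action G L) (S : subringClosed (fixed_field a))
    (pi : subring_type S) (p : nat) (X : {set G})
    (S_dvr : is_dvr pi) (S_frac : fraction_field_cond S)
    (Sbar_finite : finite_set [set: Sbar pi])
    (p_prime : prime p) (Sbar_char : p%:R = 0 :> Sbar pi)
    (split : forall V : lmodType (Lambda_bar pi),
       simple_module V -> absolutely_simple (Sbar_to_Lambda_bar pi) V)
    (X_reps : p'class_reps p X) :
  num_simple_modules (Lambda_bar pi)
    (\sum_(sigma in X) mdim (Tbar0_mod_V pi sigma))%N.
Proof.
(* [k] is [Sbar pi] itself with a field structure, so the maps out of it are reused by
   conversion. *)
pose k : finFieldType := finite_field_of (Sbar_field_like S_dvr) Sbar_finite.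
pose iota : {rmorphism k -> Tbar pi} := Sbar_to_Tbar pi.
pose j : {rmorphism k -> twisted (Tbar_action pi)} := Sbar_to_Lambda_bar pi.
pose M t : lmodType k := Tbar0_mod_V pi t.
have [m [g g_span]] : exists m (g : 'I_m -> Tbar pi), forall y,
    exists c : {ffun 'I_m -> k}, y = \sum_i iota (c i) * g i.
  have [m [g g_span]] := @dependent_spans k (restrict_scalars iota (Tbar pi)^o) _
    (Tbar_dependent S_dvr S_frac).
  by exists m, g => y; apply: g_span.
pose proj t (y : Tbar0 pi) : M t :=
  Defs.mpi (mspan_submod_closed (V_gen (pi := pi) t)) y.
have projD t : {morph proj t : u v / u + v} by move=> u v; exact: Defs.mpiD.
have projB t : {morph proj t : u v / u - v}.
  by move=> u v; apply: (addIr (proj t v)); rewrite subrK -projD subrK.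
have proj0 t : proj t 0 = 0 by rewrite -(subrr 0) projB subrr.
have projZ t (c : k) y : proj t (rpi (Jac (Tbar pi)) (iota c) * y) = c *: proj t y.
  exact: Defs.mpiZ.
have proj_eq0 t y : proj t y = 0 <-> y \in V_space t.
  by rewrite -(proj0 t); split=> [/Defs.mpi_eq|yV]; [|apply/Defs.mpi_eq]; rewrite subr0.
have V_gen0 t y : V_gen t y -> proj t y = 0.
  by move=> yV; apply/proj_eq0/asboolP => W _; apply.
have basis t : exists e : 'I_(mdim (M t)) -> M t, is_basis e.
  apply: (@mdim_basis _ _ m (fun i => proj t (rpi (Jac (Tbar pi)) (g i)))) => v.
  have [c cE] := g_span (rrepr (Defs.mrepr v)); exists c.
  have -> : v = proj t (Defs.mrepr v) by rewrite /proj Defs.mreprK.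
  rewrite -[Defs.mrepr v in LHS]rreprK cE rmorph_sum.
  rewrite (big_morph (proj t) (@projD t) (proj0 t)).
  by apply: eq_bigr => i _; rewrite rmorphM projZ.
have co_ex t : {co : {additive M t -> {ffun 'I_(mdim (M t)) -> k}} | bijective co}.
  by apply: cid; have [e /basis_coordinates] := basis t.
pose q_fun t (y : Tbar0 pi) := sval (co_ex t) (proj t y).
have qB t : zmod_morphism (q_fun t).
  by move=> u v; rewrite /q_fun projB raddfB.
pose q t : {additive Tbar0 pi -> {ffun 'I_(mdim (M t)) -> k}} :=
  HB.pack_for {additive Tbar0 pi -> {ffun 'I_(mdim (M t)) -> k}} (q_fun t)
    (GRing.isZmodMorphism.Build _ _ (q_fun t) (qB t)).
have q0 t y : proj t y = 0 <-> q t y = 0.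
  have [f coK _] := svalP (co_ex t).
  rewrite /q /= /q_fun; split=> [->|]; first by rewrite raddf0.
  by rewrite -[0 in X in X -> _](raddf0 (sval (co_ex t))) => /(can_inj coK).
apply: (@num_simple_twisted G (Tbar pi) (Tbar_action pi) k iota j p X
  (Tbar0_action pi) m g (fun t => mdim (M t)) q) => //.
- exact: Tbar_act_const.
- by move=> s y; exact: qmapE.
- move=> t u; have [f _ fK] := svalP (co_ex t).
  by exists (Defs.mrepr (f u)); rewrite /q /= /q_fun /proj Defs.mreprK fK.
- by move=> t y z; apply/q0/V_gen0; left; exists y, z.
- by move=> t r y rt; apply/q0/V_gen0; right; exists r => //; exists y.
(* V_t is the intersection of all submodules that contain its generators, and [D] is one of them. *)
move=> t D D0 DD DZ D_ideal D_cent y /q0/proj_eq0/asboolP V_y.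
suff : y \in [pred x | `[< D x >]] by move=> /asboolP.
apply: V_y.
  split=> [|c u v /asboolP Du /asboolP Dv]; first exact/asboolP.
  by apply/asboolP/DD => //; exact: DZ.
by move=> x [[u [v ->]]|[r rt [u ->]]]; apply/asboolP; [apply: D_ideal | apply: D_cent].
Qed.
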